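(* Let $n$ be a positive integer. Every semiuniform linear subdivision of $\Delta_n$ contains at least $n-3$ parallelograms if $n$ is divisible by $3$, and at least $n-1$ parallelograms otherwise. Moreover, this bound is sharp: for every positive integer $n$ there is a semiuniform linear subdivision of $\Delta_n$ with exactly $n-3$ parallelograms if $3\mid n$ and exactly $n-1$ parallelograms otherwise.
   Context: $\Delta_n=\{(x,y):x\ge0,\ y\ge0,\ x+y\le n\}$. Let $T=\mathrm{conv}\{(0,0),(1,0),(0,1)\}$, $\bar e_1=(-1,1)$, $\bar e_2=(0,-1)$, $\bar e_3=(1,0)$, and for nonnegative integers $c,w_1,w_2,w_3$ let $P_{c,w_1,w_2,w_3}$ be the Minkowski sum of $c$ copies of $T$ and $w_i$ copies of the segment $[0,\bar e_i]$ ($i=1,2,3$). A semiuniform linear subdivision of $\Delta_n$ is a polyhedral subdivision of $\Delta_n$ all of whose cells are lattice translates of polygons of the form $P_{c,0,0,0}$ or $P_{0,w_1,w_2,w_3}$ with $c,w_1,w_2,w_3\in\{0,1\}$; its two-dimensional cells are thus translates of $T$ (triangles), Minkowski sums of two of the segments $[0,\bar e_i]$ (parallelograms), or the Minkowski sum of all three (hexagons). *)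

(* Defs.v *)
(* The real numbers are an arbitrary realType. *)
From mathcomp Require Import all_boot all_order all_algebra.
From mathcomp Require Import all_classical all_reals convex.

Set Implicit Arguments.
Unset Strict Implicit.
Unset Printing Implicit Defensive.

Import GRing.Theory Num.Theory.
Local Open Scope classical_set_scope.
Local Open Scope ring_scope.

(* The regular module R^o is needed so that the product is an lmodType R. *)
Notation plane R := (R^o * R^o)%type.

Definition pt (R : realType) (x y : R) : plane R := (x, y).

Definition convex_hull (R : realType) (M : lmodType R) (A : set M) : set M :=
  smallest (@convex_set R M) A.

Definition minkowski_sum (V : zmodType) (A B : set V) : set V :=
  [set x + y | x in A & y in B].

(* The Minkowski sum of zero copies is the origin. *)
Definition minkowski_copies (V : zmodType) (k : nat) (A : set V) : set V :=
  iter k (minkowski_sum A) [set 0].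

Definition dotp (R : realType) (a p : plane R) : R :=
  (a.1 : R) * p.1 + (a.2 : R) * p.2.

Definition polytope (R : realType) (P : set (plane R)) : Prop :=
  exists V : set (plane R),
    [/\ finite_set V, V !=set0 & P = convex_hull V].

(* Nonempty faces only: F is the set of maximizers of a linear form on P;
   a = 0 gives P itself. *)
Definition face (R : realType) (P F : set (plane R)) : Prop :=
  exists a : plane R,
    F = [set p | P p /\ forall q, P q -> dotp a q <= dotp a p].

(* The empty face is not counted as a cell, so two cells are required to meet
   in a common face only when they are not disjoint. *)
Record polyhedral_complex (R : realType) (C : set (set (plane R))) : Prop :=
  PolyhedralComplex {
    complex_finite : finite_set C ;
    complex_polytope : forall P, C P -> polytope P ;
    complex_face : forall P F, C P -> face P F -> C F ;
    complex_meet : forall P Q, C P -> C Q -> P `&` Q !=set0 ->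
      face P (P `&` Q) /\ face Q (P `&` Q)
  }.

Definition polyhedral_subdivision (R : realType) (D : set (plane R))
    (C : set (set (plane R))) : Prop :=
  polyhedral_complex C /\ \bigcup_(P in C) P = D.

Definition Delta (R : realType) (n : nat) : set (plane R) :=
  [set p | [/\ 0 <= (p.1 : R), 0 <= (p.2 : R) & (p.1 : R) + p.2 <= n%:R]].

Definition unit_triangle (R : realType) : set (plane R) :=
  convex_hull [set pt 0 0; pt 1 0; pt 0 1].

Arguments Delta : clear implicits.
Arguments unit_triangle : clear implicits.

Definition e1 (R : realType) : plane R := pt (-1) 1.
Definition e2 (R : realType) : plane R := pt 0 (-1).
Definition e3 (R : realType) : plane R := pt 1 0.

Definition segment0 (R : realType) (e : plane R) : set (plane R) :=
  convex_hull [set 0; e].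

Definition polygon (R : realType) (c w1 w2 w3 : nat) : set (plane R) :=
  minkowski_sum (minkowski_copies c (unit_triangle R))
    (minkowski_sum (minkowski_copies w1 (segment0 (e1 R)))
      (minkowski_sum (minkowski_copies w2 (segment0 (e2 R)))
                     (minkowski_copies w3 (segment0 (e3 R))))).

Arguments polygon : clear implicits.

Definition lattice_translate (R : realType) (P Q : set (plane R)) : Prop :=
  exists i j : int, Q = [set pt i%:~R j%:~R + p | p in P].

Definition semiuniform_cell (R : realType) (Q : set (plane R)) : Prop :=
  (exists c : nat, (c <= 1)%N /\ lattice_translate (polygon R c 0 0 0) Q) \/
  (exists w1 w2 w3 : nat, [/\ (w1 <= 1)%N, (w2 <= 1)%N, (w3 <= 1)%N &
     lattice_translate (polygon R 0 w1 w2 w3) Q]).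

Definition semiuniform_linear_subdivision (R : realType) (n : nat)
    (C : set (set (plane R))) : Prop :=
  polyhedral_subdivision (Delta R n) C /\
  forall Q, C Q -> semiuniform_cell Q.

Definition parallelogram (R : realType) (Q : set (plane R)) : Prop :=
  [\/ lattice_translate (polygon R 0 1 1 0) Q,
      lattice_translate (polygon R 0 1 0 1) Q |
      lattice_translate (polygon R 0 0 1 1) Q].

Definition parallelograms (R : realType) (C : set (set (plane R))) :
    set (set (plane R)) :=
  C `&` @parallelogram R.

(* Main.v *)
(* Every two-dimensional cell is a union of unit lattice triangles, and two cells
   sharing such a triangle coincide. Hence in a subdivision of Delta_n each
   upward and each downward triangle of Delta_n is covered by exactly one cell.
   Comparing the numbers of upward and downward triangles gives n triangular
   cells, and p + 3 h = n (n - 1) / 2 for the numbers p of parallelograms and h of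
   hexagons. Comparing them around an interior lattice point v shows that the
   triangular cells at v are at most as many as the parallelograms whose downward
   triangle has its acute corner at v. Each triangular cell outside the three
   corners of Delta_n has an interior vertex, so n - 3 <= p; the residue of p
   modulo 3 improves this to n - 1 <= p when 3 does not divide n.

   For sharpness, put a hexagon around every interior lattice point (i, j) with
   i = j mod 3. Every unit triangle has exactly one vertex in this residue class,
   so what remains is a single triangle at each corner of Delta_n lying in the
   class, and a trapezoid, cut into a triangle and a parallelogram, at each other
   boundary point in the class. *)
Require Import Defs.
From mathcomp Require Import all_boot all_order all_algebra.
From mathcomp Require Import all_classical all_reals convex interval_inference.
From mathcomp Require Import ring lra zify.

Set Implicit Arguments.
Unset Strict Implicit.
Unset Printing Implicit Defensive.

Import Order.TTheory GRing.Theory Num.Theory.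
Local Open Scope classical_set_scope.
Local Open Scope ring_scope.

(** * Convex hulls, and the cells described by linear inequalities *)

Section Convexity.
Variable R : realType.
Implicit Types (A : set (plane R)) (p q : plane R).

Lemma pt_ind (P : plane R -> Prop) : (forall x y : R, P (pt x y)) -> forall p, P p.
Proof. by move=> h [x y]; exact: h. Qed.

Lemma pt_eq (x y x' y' : R) : x = x' -> y = y' -> pt x y = pt x' y'.
Proof. by move=> -> ->. Qed.

(** [convex_set] quantifies over scalars packed with their interval; here the scalar is a plain real
    with explicit bounds, as linear arithmetic needs it. *)
Lemma convex_setE A : convex_set A <->
  forall p q (t : R), A p -> A q -> 0 <= t <= 1 ->
    A (pt (t * p.1 + (1 - t) * q.1) (t * p.2 + (1 - t) * q.2)).
Proof.
split=> [cA p q t Ap Aq t01|cA p q t].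
  have i01 : Itv.spec (@Itv.num_sem R) (Itv.Real `[0%Z, 1%Z]%R) t.
    rewrite /Itv.spec /Itv.num_sem; apply/andP; split; first exact: num_real.
    by rewrite in_itv.
  have := cA p q (Itv.mk i01); rewrite !inE.
  by move=> /(_ Ap Aq).
rewrite !inE => Ap Aq.
by apply: (cA p q t%:num) => //; rewrite ge0 le1.
Qed.

Lemma hull_min A B : convex_set B -> A `<=` B -> convex_hull A `<=` B.
Proof. exact: smallest_sub. Qed.

Lemma convex_hullP A p :
  convex_hull A p <-> forall B, convex_set B -> A `<=` B -> B p.
Proof.
by split=> [hp B cB AB|h]; [exact: (hull_min cB AB) | move=> B [cB AB]; exact: h].
Qed.

Lemma hull_eq A B : convex_set B -> A `<=` B ->
  (forall X, convex_set X -> A `<=` X -> B `<=` X) -> convex_hull A = B.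
Proof.
move=> cB AB BX; apply/seteqP; split; first exact: hull_min.
by move=> p Bp; apply/convex_hullP => X cX AX; exact: (BX X cX AX).
Qed.

Lemma convex_triangle A (a b x y : R) : convex_set A ->
  A (pt a b) -> A (pt (a + 1) b) -> A (pt a (b + 1)) ->
  0 <= x -> 0 <= y -> x + y <= 1 -> A (pt (a + x) (b + y)).
Proof.
move=> /convex_setE cA O E N x0 y0 xy1.
have [s0|s0] := eqVneq (x + y) 0.
  by rewrite (_ : pt _ _ = pt a b) //; apply: pt_eq; lra.
have {}s0 : 0 < x + y by rewrite lt_def s0 addr_ge0.
have xs : 0 <= x / (x + y) <= 1.
  by rewrite divr_ge0 ?ler_pdivrMr ?mul1r ?lerDl // ltW.
have s1 : 0 <= x + y <= 1 by rewrite ltW.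
(* First the point of the hypotenuse with weights x/(x+y) and y/(x+y), then its combination with the
   corner (a, b). *)
have := cA _ _ (x + y) (cA _ _ (x / (x + y)) E N xs) O s1.
by congr A; apply: pt_eq => /=; field; exact: lt0r_neq0.
Qed.

Lemma unit_triangleE : unit_triangle R =
  [set p | [/\ 0 <= (p.1 : R), 0 <= (p.2 : R) & (p.1 : R) + p.2 <= 1]].
Proof.
apply: hull_eq.
- apply/convex_setE => p q t [p1 p2 p3] [q1 q2 q3] /andP[t0 t1].
  split=> /=; nra.
- by move=> p [[->|->]|->]; split=> /=; lra.
- move=> X cX sX; elim/pt_ind => x y [/= x0 y0 xy1].
  rewrite -[x]add0r -[y]add0r; apply: convex_triangle; rewrite ?add0r //.
  + by apply: sX; left; left.
  + by apply: sX; left; right.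
  + by apply: sX; right.
Qed.

Lemma segment0E (e : plane R) :
  segment0 e = [set pt (t * e.1) (t * e.2) | t in [set t : R | 0 <= t <= 1]].
Proof.
apply: hull_eq.
- apply/convex_setE => _ _ t [a /= a01 <-] [b /= b01 <-] t01.
  exists (t * a + (1 - t) * b) => /=; first nra.
  by apply: pt_eq; ring.
- move=> p [->|->].
    by exists 0; [rewrite /= lexx ler01 | apply: pt_eq; rewrite mul0r].
  exists 1; first by rewrite /= lexx ler01.
  by elim/pt_ind: e => x y /=; rewrite !mul1r.
- move=> X /convex_setE cX sX _ [t /= t01 <-].
  have O : X 0 by apply: sX; left.
  have E : X e by apply: sX; right.
  have := cX _ _ t E O t01; rewrite !mulr0 !addr0.
  by [].
Qed.

Lemma minkowski_copies0 A : minkowski_copies 0 A = [set 0].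
Proof. by []. Qed.

Lemma minkowski_copies1 A : minkowski_copies 1 A = A.
Proof.
apply/seteqP; split=> [_ [p Ap [_ -> <-]]|p Ap]; first by rewrite addr0.
by exists p => //; exists 0 => //; rewrite addr0.
Qed.

Lemma minkowski_copies_segment0 (w : nat) (e : plane R) : (w <= 1)%N ->
  minkowski_copies w (segment0 e) =
  [set pt (t * e.1) (t * e.2) | t in [set t : R | 0 <= t <= w%:R]].
Proof.
case: w => [|[|//]] _; last by rewrite minkowski_copies1 segment0E.
apply/seteqP; split=> [_ ->|_ [t /= t01 <-]].
  by exists 0 => /=; [lra | apply: pt_eq; ring].
by rewrite (_ : t = 0) ?mul0r //; lra.
Qed.

Lemma minkowski_copies_triangle (c : nat) : (c <= 1)%N ->
  minkowski_copies c (unit_triangle R) =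
  [set p | [/\ 0 <= (p.1 : R), 0 <= (p.2 : R) & (p.1 : R) + p.2 <= c%:R]].
Proof.
case: c => [|[|//]] _; last by rewrite minkowski_copies1 unit_triangleE.
apply/seteqP; split=> [_ ->|]; first by split=> /=; lra.
by elim/pt_ind => x y [/= x0 y0 xy0]; apply: pt_eq; lra.
Qed.

(* [cell (c, w1, w2, w3, k, l)] is the translate by (k, l) of the polygon
   P_{c,w1,w2,w3}, whose edges have the directions of x = 0, y = 0, x + y = 0. *)
Definition label := (nat * nat * nat * nat * int * int)%type.

Definition cell (L : label) : set (plane R) :=
  let: (c, w1, w2, w3, k, l) := L in
  [set p | [/\ k%:~R - w1%:R <= (p.1 : R) <= k%:~R + w3%:R + c%:R,
               l%:~R - w2%:R <= (p.2 : R) <= l%:~R + w1%:R + c%:R &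
               k%:~R + l%:~R - w2%:R <= (p.1 : R) + p.2 <=
               k%:~R + l%:~R + w3%:R + c%:R]].

Lemma zonogonE (w1 w2 w3 : nat) : (w1 <= 1)%N -> (w2 <= 1)%N -> (w3 <= 1)%N ->
  polygon R 0 w1 w2 w3 = [set p | exists s t u : R,
    [/\ 0 <= s <= w1%:R, 0 <= t <= w2%:R, 0 <= u <= w3%:R &
       p = pt (u - s) (s - t)]].
Proof.
move=> v1 v2 v3; rewrite /polygon !minkowski_copies_segment0 // minkowski_copies0.
apply/seteqP; split.
  move=> _ [_ -> [_ [_ [s s01 <-] [_ [_ [t t01 <-] [_ [u u01 <-] <-]] <-]] <-]].
  by exists s, t, u; split=> //; apply: pt_eq => /=; ring.
move=> _ [s [t [u [s01 t01 u01 ->]]]].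
exists 0 => //; exists (pt (u - s) (s - t)); last exact: add0r.
exists (pt (s * -1) (s * 1)); first by exists s.
exists (pt u (- t)); last by apply: pt_eq => /=; ring.
exists (pt (t * 0) (t * -1)); first by exists t.
exists (pt (u * 1) (u * 0)); first by exists u.
by apply: pt_eq => /=; ring.
Qed.

Lemma translate_zonogon (w1 w2 w3 : nat) (k l : int) :
  (w1 <= 1)%N -> (w2 <= 1)%N -> (w3 <= 1)%N ->
  [set pt k%:~R l%:~R + p | p in polygon R 0 w1 w2 w3] =
  cell (0%N, w1, w2, w3, k, l).
Proof.
move=> v1 v2 v3; rewrite zonogonE //.
have := ler0n R w1; have := ler0n R w2; have := ler0n R w3.
set a1 := w1%:R; set a2 := w2%:R; set a3 := w3%:R => a30 a20 a10.
set K : R := k%:~R; set L : R := l%:~R.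
apply/seteqP; split.
  move=> _ [_ [s [t [u [s01 t01 u01 ->]]]] <-].
  by split=> /=; rewrite -/K -/L; lra.
elim/pt_ind => x y [/=]; rewrite -/K -/L -/a1 -/a2 -/a3 => hx hy hz.
(* Once s is chosen, t = s + L - y and u = s + x - K are forced. Their bounds confine s between
   three lower and three upper bounds, and the inequalities of the cell put each lower bound below
   each upper one, so the largest lower bound works. *)
pose s := Num.max 0 (Num.max (K - x) (y - L)).
have [s0 [sx sy]] : 0 <= s /\ (K - x <= s /\ y - L <= s).
  by rewrite /s !le_max !lexx !orbT.
have sm b : 0 <= b -> K - x <= b -> y - L <= b -> s <= b.
  by move=> b0 bx by_; rewrite /s !ge_max b0 bx.
have := sm a1; have := sm (a3 + K - x); have := sm (a2 + y - L) => h2 h3 h1.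
exists (pt (x - K) (y - L)); last by apply: pt_eq => /=; rewrite -/K -/L; ring.
exists s, (s + L - y), (s + x - K); split; last by apply: pt_eq; ring.
all: rewrite -/a1 -/a2 -/a3; apply/andP; split=> //; lra.
Qed.

Lemma translate_triangle (c : nat) (k l : int) : (c <= 1)%N ->
  [set pt k%:~R l%:~R + p | p in polygon R c 0 0 0] =
  cell (c, 0%N, 0%N, 0%N, k, l).
Proof.
move=> c1; rewrite /polygon !minkowski_copies0 minkowski_copies_triangle //.
apply/seteqP; split.
  move=> _ [_ [p + [_ [_ -> [_ [_ -> [_ -> <-]] <-]] <-]] <-].
  elim/pt_ind: p => x y [/= *]; split=> /=; lra.
elim/pt_ind => x y [/= hx hy hz].
exists (pt (x - k%:~R) (y - l%:~R)); last by apply: pt_eq => /=; ring.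
exists (pt (x - k%:~R) (y - l%:~R)); first by split=> /=; lra.
exists 0; last by apply: pt_eq => /=; ring.
by exists 0 => //; exists 0; [exists 0 => //; exists 0 => // | ]; apply: pt_eq => /=; ring.
Qed.

Definition valid (L : label) : bool :=
  let: (c, w1, w2, w3, _, _) := L in
  [&& c <= 1, w1 <= 1, w2 <= 1, w3 <= 1 & (c == 0) || (w1 + w2 + w3 == 0)]%N.

Lemma semiuniform_cellP (Q : set (plane R)) :
  semiuniform_cell Q <-> exists2 L, valid L & Q = cell L.
Proof.
split.
  case=> [[c [c1 [k [l ->]]]]|[w1 [w2 [w3 [v1 v2 v3 [k [l ->]]]]]]].
    by exists (c, 0%N, 0%N, 0%N, k, l); [rewrite /= c1 orbT | exact: translate_triangle].
  by exists (0%N, w1, w2, w3, k, l); [rewrite /= v1 v2 v3 | exact: translate_zonogon].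
case=> [[[[[[c w1] w2] w3] k] l]] /and5P[c1 v1 v2 v3 cw] ->.
case/orP: cw => [/eqP c0|].
  right; exists w1, w2, w3; split=> //; exists k, l.
  by rewrite translate_zonogon // c0.
rewrite !addn_eq0 => /andP[/andP[/eqP-> /eqP->] /eqP->].
by left; exists c; split=> //; exists k, l; rewrite translate_triangle.
Qed.

Lemma parallelogramP (Q : set (plane R)) :
  parallelogram Q <-> exists k l : int, [\/ Q = cell (0, 1, 1, 0, k, l)%N,
    Q = cell (0, 1, 0, 1, k, l)%N | Q = cell (0, 0, 1, 1, k, l)%N].
Proof.
split=> [[] [k [l ->]]|[k [l []->]]]; try exists k, l.
- by apply: Or31; rewrite translate_zonogon.
- by apply: Or32; rewrite translate_zonogon.
- by apply: Or33; rewrite translate_zonogon.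
- by apply: Or31; exists k, l; rewrite translate_zonogon.
- by apply: Or32; exists k, l; rewrite translate_zonogon.
- by apply: Or33; exists k, l; rewrite translate_zonogon.
Qed.

End Convexity.
Arguments cell R L : clear implicits.

(** * Faces of the cells *)

Ltac cell_eq_lra :=
  let H := fresh in
  apply/seteqP; split; elim/pt_ind=> ? ?; intro H; move: H => /= H;
  decompose [and and3] H; clear H; do !split=> /=; lra.

Section Faces.
Variable R : realType.
Implicit Types (P Q F : set (plane R)) (p q a : plane R) (L : label).

Definition argmax a P : set (plane R) :=
  [set p | P p /\ forall q, P q -> dotp a q <= dotp a p].

(** Since f and g reach their maxima at the common point v, a nonnegative combination is maximal
    exactly where every summand with nonzero coefficient is. *)
Lemma argmax_pair P (f g : plane R -> R) a (s t U V : R) v :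
  (forall p, dotp a p = s * f p + t * g p) -> 0 <= s -> 0 <= t ->
  (forall p, P p -> f p <= U /\ g p <= V) -> P v -> f v = U -> g v = V ->
  argmax a P = [set p | [/\ P p, s != 0 -> f p = U & t != 0 -> g p = V]].
Proof.
move=> aE s0 t0 UV Pv fv gv; apply/seteqP; split=> p /=.
  move=> [Pp /(_ v Pv)]; rewrite !aE fv gv => le.
  have [fU gV] := UV p Pp.
  have : s * f p <= s * U by exact: ler_wpM2l.
  have : t * g p <= t * V by exact: ler_wpM2l.
  move=> let_ les; split=> // [sN0|tN0].
    by apply: (mulfI sN0); lra.
  by apply: (mulfI tN0); lra.
move=> [Pp sU tV]; split=> // q Pq; have [fq gq] := UV q Pq; rewrite !aE.
have -> : s * f p = s * U.
  by have [->|/sU ->//] := eqVneq s 0; rewrite !mul0r.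
have -> : t * g p = t * V.
  by have [->|/tV ->//] := eqVneq t 0; rewrite !mul0r.
by apply: lerD; exact: ler_wpM2l.
Qed.

(* The polygon itself, its edges on the lines x = max, x + y = max, y = max,
   x = min, x + y = min, y = min in this cyclic order, and the vertices between
   consecutive edges, starting with the one between x = max and x + y = max.
   Entries may coincide when some of the edges degenerate to points. *)
Definition edges L : seq label :=
  let: (c, w1, w2, w3, k, l) := L in
  [:: (0%N, 0%N, w2, 0%N, k + w3%:Z + c%:Z, l);
      (0%N, (w1 + c)%N, 0%N, 0%N, k + w3%:Z + c%:Z, l);
      (0%N, 0%N, 0%N, w3, k - w1%:Z, l + w1%:Z + c%:Z);
      (0%N, 0%N, (w2 + c)%N, 0%N, k - w1%:Z, l + w1%:Z + c%:Z);
      (0%N, w1, 0%N, 0%N, k, l - w2%:Z);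
      (0%N, 0%N, 0%N, (w3 + c)%N, k, l - w2%:Z)].

Definition vertex (k l : int) : label := (0%N, 0%N, 0%N, 0%N, k, l).

Definition vertices L : seq label :=
  let: (c, w1, w2, w3, k, l) := L in
  [:: vertex (k + w3%:Z + c%:Z) l;
      vertex (k + w3%:Z - w1%:Z) (l + w1%:Z + c%:Z);
      vertex (k - w1%:Z) (l + w1%:Z + c%:Z);
      vertex (k - w1%:Z) (l - w2%:Z + w1%:Z);
      vertex k (l - w2%:Z);
      vertex (k + w3%:Z + c%:Z) (l - w2%:Z)].

Definition faces L : seq label := L :: edges L ++ vertices L.

Lemma argmax_cases a (f g : plane R -> R) (s t U V : R) v L L1 L2 L3 :
  0 <= s -> 0 <= t -> (forall p, dotp a p = s * f p + t * g p) ->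
  (forall p, cell R L p -> f p <= U /\ g p <= V) ->
  cell R L v -> f v = U -> g v = V ->
  cell R L `&` [set p | f p = U] = cell R L1 ->
  cell R L `&` [set p | g p = V] = cell R L2 ->
  cell R L `&` [set p | f p = U /\ g p = V] = cell R L3 ->
  argmax a (cell R L) = cell R (if s == 0 then if t == 0 then L else L2
                                else if t == 0 then L1 else L3).
Proof.
move=> s0 t0 aE UV Pv fv gv e1 e2 e3; rewrite (argmax_pair aE s0 t0 UV Pv fv gv).
case: (eqVneq s 0) => s1; case: (eqVneq t 0) => t1;
  rewrite -?e1 -?e2 -?e3;
  apply/seteqP; split=> p /=.
- by case.
- by [].
- by case=> ? _ gV; split=> //; exact: gV.
- by case=> ? gV; split.
- by case=> ? fU _; split=> //; exact: fU.
- by case=> ? fU; split.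
- by case=> ? fU gV; split=> //; split; [exact: fU | exact: gV].
- by case=> ? [fU gV]; split.
Qed.

(* Every linear form is a nonnegative combination of two consecutive outer
   normals among x, x + y, y, -x, -x - y, -y, and the corresponding maxima are
   attained simultaneously on each cell. *)
Lemma argmax_cone (i : nat) (s t : R) L : (i < 6)%N -> 0 <= s -> 0 <= t ->
  let n := [:: pt 1 0; pt 1 1; pt 0 1; pt (-1) 0; pt (-1) (-1); pt 0 (-1)] in
  let a := nth 0 n i in let b := nth 0 n (i.+1 %% 6) in
  argmax (pt (s * a.1 + t * b.1) (s * a.2 + t * b.2)) (cell R L) =
  cell R (if s == 0 then if t == 0 then L else nth L (edges L) (i.+1 %% 6)
          else if t == 0 then nth L (edges L) i else nth L (vertices L) i).
Proof.
case: L => [[[[[c w1] w2] w3] k] l] i6 s0 t0 /=.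
have := ler0n R w1; have := ler0n R w2; have := ler0n R w3; have := ler0n R c.
move=> c0 w30 w20 w10.
pose x (p : plane R) : R := p.1; pose y (p : plane R) : R := p.2.
pose z p := x p + y p.
pose K : R := k%:~R; pose M : R := l%:~R.
pose X1 := K + w3%:R + c%:R; pose X0 := K - w1%:R.
pose Y1 := M + w1%:R + c%:R; pose Y0 := M - w2%:R.
pose Z1 := K + M + w3%:R + c%:R; pose Z0 := K + M - w2%:R.
case: i i6 => [|[|[|[|[|[|//]]]]]] _ /=.
- apply: (@argmax_cases _ x z s t X1 Z1 (pt X1 M)
    (c, w1, w2, w3, k, l) _ _ _ s0 t0);
    rewrite /x /y /z /X1 /X0 /Y1 /Y0 /Z1 /Z0 /K /M /=; clear -c0 w10 w20 w30.
  + by elim/pt_ind=> ? ?; rewrite /dotp /=; ring.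
  + by elim/pt_ind=> ? ? [/= ? ? ?]; split; lra.
  + by split=> /=; lra.
  + by rewrite /=; ring.
  + by rewrite /=; ring.
  + cell_eq_lra.
  + cell_eq_lra.
  + cell_eq_lra.
- apply: (@argmax_cases _ z y s t Z1 Y1 (pt (Z1 - Y1) Y1)
    (c, w1, w2, w3, k, l) _ _ _ s0 t0);
    rewrite /x /y /z /X1 /X0 /Y1 /Y0 /Z1 /Z0 /K /M /=; clear -c0 w10 w20 w30.
  + by elim/pt_ind=> ? ?; rewrite /dotp /=; ring.
  + by elim/pt_ind=> ? ? [/= ? ? ?]; split; lra.
  + by split=> /=; lra.
  + by rewrite /=; ring.
  + by rewrite /=; ring.
  + cell_eq_lra.
  + cell_eq_lra.
  + cell_eq_lra.
- apply: (@argmax_cases _ y (fun p => - x p) s t Y1 (- X0) (pt X0 Y1)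
    (c, w1, w2, w3, k, l) _ _ _ s0 t0);
    rewrite /x /y /z /X1 /X0 /Y1 /Y0 /Z1 /Z0 /K /M /=; clear -c0 w10 w20 w30.
  + by elim/pt_ind=> ? ?; rewrite /dotp /=; ring.
  + by elim/pt_ind=> ? ? [/= ? ? ?]; split; lra.
  + by split=> /=; lra.
  + by rewrite /=; ring.
  + by rewrite /=; ring.
  + cell_eq_lra.
  + cell_eq_lra.
  + cell_eq_lra.
- apply: (@argmax_cases _ (fun p => - x p) (fun p => - z p) s t (- X0) (- Z0)
    (pt X0 (Z0 - X0))
    (c, w1, w2, w3, k, l) _ _ _ s0 t0);
    rewrite /x /y /z /X1 /X0 /Y1 /Y0 /Z1 /Z0 /K /M /=; clear -c0 w10 w20 w30.
  + by elim/pt_ind=> ? ?; rewrite /dotp /=; ring.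
  + by elim/pt_ind=> ? ? [/= ? ? ?]; split; lra.
  + by split=> /=; lra.
  + by rewrite /=; ring.
  + by rewrite /=; ring.
  + cell_eq_lra.
  + cell_eq_lra.
  + cell_eq_lra.
- apply: (@argmax_cases _ (fun p => - z p) (fun p => - y p) s t (- Z0) (- Y0)
    (pt K Y0)
    (c, w1, w2, w3, k, l) _ _ _ s0 t0);
    rewrite /x /y /z /X1 /X0 /Y1 /Y0 /Z1 /Z0 /K /M /=; clear -c0 w10 w20 w30.
  + by elim/pt_ind=> ? ?; rewrite /dotp /=; ring.
  + by elim/pt_ind=> ? ? [/= ? ? ?]; split; lra.
  + by split=> /=; lra.
  + by rewrite /=; ring.
  + by rewrite /=; ring.
  + cell_eq_lra.
  + cell_eq_lra.
  + cell_eq_lra.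
- apply: (@argmax_cases _ (fun p => - y p) x s t (- Y0) X1 (pt X1 Y0)
    (c, w1, w2, w3, k, l) _ _ _ s0 t0);
    rewrite /x /y /z /X1 /X0 /Y1 /Y0 /Z1 /Z0 /K /M /=; clear -c0 w10 w20 w30.
  + by elim/pt_ind=> ? ?; rewrite /dotp /=; ring.
  + by elim/pt_ind=> ? ? [/= ? ? ?]; split; lra.
  + by split=> /=; lra.
  + by rewrite /=; ring.
  + by rewrite /=; ring.
  + cell_eq_lra.
  + cell_eq_lra.
  + cell_eq_lra.
Qed.

End Faces.

Section FaceLattice.
Variable R : realType.
Implicit Types (P Q F : set (plane R)) (p q a : plane R) (L : label).

Lemma edges_faces i L : nth L (edges L) i \in faces L.
Proof.
rewrite inE mem_cat; have [/(mem_nth L) ->|/(nth_default L) ->] := ltnP i (size (edges L)).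
  by rewrite orbT.
by rewrite eqxx.
Qed.

Lemma vertices_faces i L : nth L (vertices L) i \in faces L.
Proof.
rewrite inE mem_cat; have [/(mem_nth L) ->|/(nth_default L) ->] := ltnP i (size (vertices L)).
  by rewrite !orbT.
by rewrite eqxx.
Qed.

(** The signs of x and y, and the comparison of x with y when the signs agree, tell which of the six
    cones of [argmax_cone] contains the form. *)
Lemma argmax_cell a L : exists2 L', L' \in faces L & argmax a (cell R L) = cell R L'.
Proof.
have cone (i : nat) (s t : R) : (i < 6)%N -> 0 <= s -> 0 <= t ->
    let n := [:: pt 1 0; pt 1 1; pt 0 1; pt (-1) 0; pt (-1) (-1); pt 0 (-1)] in
    let u := nth 0 n i in let v := nth 0 n (i.+1 %% 6) in
    a = pt (s * u.1 + t * v.1) (s * u.2 + t * v.2) ->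
    exists2 L', L' \in faces L & argmax a (cell R L) = cell R L'.
  move=> i6 s0 t0 n u v ->; rewrite argmax_cone //; eexists; last by [].
  by case: eqP => _; case: eqP => _; rewrite ?edges_faces ?vertices_faces // inE eqxx.
elim/pt_ind: a cone => x y cone.
have [x0|x0] := leP 0 x; have [y0|y0] := leP 0 y.
- have [xy|xy] := leP y x.
    by apply: (cone 0%N (x - y) y) => //=; [lra | apply: pt_eq; ring].
  by apply: (cone 1%N x (y - x)) => //=; [lra | apply: pt_eq; ring].
- by apply: (cone 5%N (- y) x) => //=; [lra | apply: pt_eq; ring].
- by apply: (cone 2%N y (- x)) => //=; [lra | apply: pt_eq; ring].
- have [xy|xy] := leP y x.
    by apply: (cone 4%N (- x) (x - y)) => //=; [lra | lra | apply: pt_eq; ring].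
  by apply: (cone 3%N (y - x) (- y)) => //=; [lra | lra | apply: pt_eq; ring].
Qed.

Lemma faceE P F : face P F <-> exists a, F = argmax a P.
Proof. by []. Qed.

(** The coefficients (0, 0), (1, 0) and (1, 1) in [argmax_cone] produce the polygon itself, its edge
    i and its vertex i. *)
Lemma faces_face L L' : L' \in faces L -> face (cell R L) (cell R L').
Proof.
have cone (i : nat) (s t : R) L1 : (i < 6)%N -> 0 <= s -> 0 <= t ->
  L1 = (if s == 0 then if t == 0 then L else nth L (edges L) (i.+1 %% 6)
        else if t == 0 then nth L (edges L) i else nth L (vertices L) i) ->
  face (cell R L) (cell R L1).
  by move=> i6 s0 t0 ->; apply/faceE; eexists; rewrite -argmax_cone.
rewrite inE mem_cat => /orP[/eqP ->|/orP[]].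
- by apply: (cone 0%N 0 0) => //; rewrite eqxx.
- move=> /(nthP L)[i i6 <-]; have {}i6 : (i < 6)%N by case: L {cone} i6 => [[[[[]]]]].
  by apply: (cone i 1 0) => //; rewrite eqxx oner_eq0.
- move=> /(nthP L)[i i6 <-]; have {}i6 : (i < 6)%N by case: L {cone} i6 => [[[[[]]]]].
  by apply: (cone i 1 1) => //; rewrite oner_eq0.
Qed.

Lemma face_cellP L F :
  face (cell R L) F <-> exists2 L', L' \in faces L & F = cell R L'.
Proof.
split=> [/faceE[a ->]|[L' LL' ->]]; last exact: faces_face.
exact: argmax_cell.
Qed.

Lemma label_eq (c w1 w2 w3 c' w1' w2' w3' : nat) (k l k' l' : int) :
  c = c' -> w1 = w1' -> w2 = w2' -> w3 = w3' -> k = k' -> l = l' ->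
  (c, w1, w2, w3, k, l) = (c', w1', w2', w3', k', l') :> label.
Proof. by do 6![move=> ->]. Qed.

Lemma faces_vertex k l L : L \in faces (vertex k l) -> L = vertex k l.
Proof.
rewrite !inE /vertex; do 12?[case/orP]; move=> /eqP ->; apply: label_eq; lia.
Qed.

Lemma faces_segment w1 w2 w3 k l L : (w1 + w2 = 0 \/ w1 + w3 = 0 \/ w2 + w3 = 0)%N ->
  L \in faces (0%N, w1, w2, w3, k, l) ->
  [\/ L = (0%N, w1, w2, w3, k, l), L = vertex (k + w3%:Z) (l - w2%:Z) |
      L = vertex (k - w1%:Z) (l + w1%:Z)].
Proof.
move=> w0; rewrite !inE /vertex; do 12?[case/orP]; move=> /eqP ->.
all: case: w0 => [|[]] w0; have [?|?] := leqP (w1 + w2 + w3) 0.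
all: try by apply: Or31; apply: label_eq; lia.
all: try by apply: Or32; apply: label_eq; lia.
all: try by apply: Or33; apply: label_eq; lia.
Qed.

Lemma edges_dir L i : (i < 6)%N -> exists w1 w2 w3 k l,
  [/\ nth L (edges L) i = (0%N, w1, w2, w3, k, l),
      (w1 + w2 = 0 \/ w1 + w3 = 0 \/ w2 + w3 = 0)%N,
      vertex (k + w3%:Z) (l - w2%:Z) \in vertices L &
      vertex (k - w1%:Z) (l + w1%:Z) \in vertices L].
Proof.
case: L => [[[[[c w1] w2] w3] k] l].
case: i => [|[|[|[|[|[|//]]]]]] _; do 5!eexists; (split; [by [] |
  first [by left | by right; left | by right; right] | |]).
all: rewrite !inE.
all: try (apply/orP; left; apply/eqP/label_eq; lia).
all: try (do 1!(apply/orP; right); apply/orP; left; apply/eqP/label_eq; lia).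
all: try (do 2!(apply/orP; right); apply/orP; left; apply/eqP/label_eq; lia).
all: try (do 3!(apply/orP; right); apply/orP; left; apply/eqP/label_eq; lia).
all: try (do 4!(apply/orP; right); apply/orP; left; apply/eqP/label_eq; lia).
all: try (do 5!(apply/orP; right); apply/eqP/label_eq; lia).
Qed.

(** An edge has only itself and its two ends as faces, and these ends are vertices of the polygon; a
    vertex has only itself. *)
Lemma faces_trans L1 L2 L3 :
  L2 \in faces L1 -> L3 \in faces L2 -> L3 \in faces L1.
Proof.
rewrite [in X in X -> _]inE mem_cat => /orP[/eqP-> //|/orP[]].
  move=> /(nthP L1)[i i6 <-]; have {}i6 : (i < 6)%N by case: L1 i6 => [[[[[]]]]].
  have [w1 [w2 [w3 [k [l [E w0 V1 V2]]]]]] := edges_dir L1 i6.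
  rewrite E => /(faces_segment w0)[] ->; first by rewrite -E edges_faces.
    by rewrite inE mem_cat V1 !orbT.
  by rewrite inE mem_cat V2 !orbT.
move=> V2 L3f; suff -> : L3 = L2 by rewrite inE mem_cat V2 !orbT.
move: V2 L3f; case: L1 => [[[[[c w1] w2] w3] k] l].
by rewrite !inE => /or4P[|||/or3P[]] /eqP -> /faces_vertex.
Qed.

(** For sets of maximizers on an arbitrary convex set transitivity can fail; on a cell it follows
    from the explicit list of faces. *)
Lemma face_trans L F G : face (cell R L) F -> face F G -> face (cell R L) G.
Proof.
move=> /face_cellP[L1 L1f ->] /face_cellP[L2 L2f ->].
exact/faces_face/(faces_trans L1f).
Qed.

End FaceLattice.

(** * Intersections of cells *)

Section CellGeometry.
Variable R : realType.
Implicit Types (P Q F : set (plane R)) (p q a : plane R) (L : label).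

Lemma cell_convex L : convex_set (cell R L).
Proof.
case: L => [[[[[c w1] w2] w3] k] l]; apply/convex_setE.
elim/pt_ind=> x y; elim/pt_ind=> x' y' t [/= hx hy hz] [/= hx' hy' hz'] t01.
have mid (lo hi u v : R) : lo <= u <= hi -> lo <= v <= hi ->
    lo <= t * u + (1 - t) * v <= hi by nra.
split=> /=; [exact: mid | exact: mid |].
rewrite [X in _ <= X <= _](_ : _ = t * (x + y) + (1 - t) * (x' + y')); first exact: mid.
ring.
Qed.

Lemma zonogon_cellP (w1 w2 w3 : nat) (k l : int) p :
  (w1 <= 1)%N -> (w2 <= 1)%N -> (w3 <= 1)%N ->
  cell R (0%N, w1, w2, w3, k, l) p -> exists s t u : R,
    [/\ 0 <= s <= 1, 0 <= t <= 1, 0 <= u <= 1 &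
        p = pt (k%:~R + u * w3%:R - s * w1%:R) (l%:~R + s * w1%:R - t * w2%:R)].
Proof.
move=> v1 v2 v3; rewrite -translate_zonogon // zonogonE //.
move=> [_ [s [t [u [s01 t01 u01 ->]]]] <-].
have unit (w : nat) (r : R) : (w <= 1)%N -> 0 <= r <= w%:R ->
    0 <= r <= 1 /\ r * w%:R = r.
  by case: w => [|[|//]] _ r01; split; lra.
have [s1 s2] := unit _ _ v1 s01; have [t1 t2] := unit _ _ v2 t01.
have [u1 u2] := unit _ _ v3 u01.
by exists s, t, u; split=> //; apply: pt_eq => /=; rewrite ?s2 ?t2 ?u2; ring.
Qed.

(** A zonogon is the hull of the images of the eight corners of a cube; a cell without segments is a
    point or the hull of three vertices. *)
Lemma polytope_cell L : valid L -> polytope (cell R L).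
Proof.
case: L => [[[[[c w1] w2] w3] k] l] /and5P[c1 v1 v2 v3 cw].
case/orP: cw => [/eqP->|].
  pose f (b : bool * bool * bool) : plane R :=
    pt (k%:~R + b.2%:R * w3%:R - b.1.1%:R * w1%:R)
       (l%:~R + b.1.1%:R * w1%:R - b.1.2%:R * w2%:R).
  exists (range f); split; first exact/finite_image/finite_finset.
    by exists (f (true, true, true)); exists (true, true, true).
  apply/esym/hull_eq; first exact: cell_convex.
    move=> _ [[[b1 b2] b3] _ <-].
    have bit (b : bool) (w : nat) : 0 <= (b%:R * w%:R : R) <= w%:R.
      by case: b; rewrite /= ?mul1r ?mul0r lexx ler0n.
    have := bit b1 w1; have := bit b2 w2; have := bit b3 w3.
    rewrite /f /=; set s1 := _ * _; set s2 := _ * _; set s3 := _ * _ => h3 h2 h1.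
    by split=> /=; lra.
  move=> X /convex_setE cX sX p /(zonogon_cellP v1 v2 v3) [s [t [u [s01 t01 u01 ->]]]].
  (* From the corners of the cube to the point (s, t, u), one coordinate is interpolated at a
     time. *)
  have vtx b1 b2 b3 : X (f (b1, b2, b3)) by apply: sX; exists (b1, b2, b3).
  have step1 (b2 b3 : bool) : X (pt (k%:~R + b3%:R * w3%:R - s * w1%:R)
       (l%:~R + s * w1%:R - b2%:R * w2%:R)).
    have := cX _ _ s (vtx true b2 b3) (vtx false b2 b3) s01.
    by congr X; apply: pt_eq => /=; ring.
  have step2 (b3 : bool) : X (pt (k%:~R + b3%:R * w3%:R - s * w1%:R)
       (l%:~R + s * w1%:R - t * w2%:R)).
    have := cX _ _ t (step1 true b3) (step1 false b3) t01.
    by congr X; apply: pt_eq => /=; ring.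
  have := cX _ _ u (step2 true) (step2 false) u01.
  by congr X; apply: pt_eq => /=; ring.
rewrite !addn_eq0 => /andP[/andP[/eqP-> /eqP->] /eqP->].
case: c c1 => [|[|//]] _.
  exists [set pt (k%:~R : R) l%:~R].
  split; [exact: finite_set1 | by exists (pt k%:~R l%:~R) |].
  apply/esym/hull_eq; first exact: cell_convex.
    by move=> _ ->; split=> /=; lra.
  move=> X cX sX; elim/pt_ind=> x y [/= hx hy hz]; apply: sX.
  by apply: pt_eq; lra.
exists [set pt (k%:~R : R) l%:~R; pt (k%:~R + 1) l%:~R; pt k%:~R (l%:~R + 1)].
split; [by rewrite !finite_setU; do !split; exact: finite_set1 |
        by exists (pt k%:~R l%:~R); left; left |].
apply/esym/hull_eq; first exact: cell_convex.
  by move=> _ [[]|] ->; split=> /=; lra.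
move=> X cX sX; elim/pt_ind=> x y [/= hx hy hz].
rewrite (_ : pt x y = pt (k%:~R + (x - k%:~R)) (l%:~R + (y - l%:~R))); last first.
  by apply: pt_eq; ring.
apply: convex_triangle => //; try lra.
- by apply: sX; left; left.
- by apply: sX; left; right.
- by apply: sX; right.
Qed.

Lemma segment_ends w1 w2 w3 k l :
  vertex (k + w3%:Z) (l - w2%:Z) \in faces (0%N, w1, w2, w3, k, l) /\
  vertex (k - w1%:Z) (l + w1%:Z) \in faces (0%N, w1, w2, w3, k, l).
Proof.
split; rewrite inE mem_cat /= !inE.
  have -> : vertex (k + w3%:Z) (l - w2%:Z) = vertex (k + w3%:Z + 0%:Z) (l - w2%:Z).
    by rewrite addr0.
  by rewrite eqxx !orbT.
have -> : vertex (k - w1%:Z) (l + w1%:Z) = vertex (k - w1%:Z) (l + w1%:Z + 0%:Z).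
  by rewrite addr0.
by rewrite eqxx !orbT.
Qed.

(** The hypothesis puts both segments on one lattice line. Their ends are lattice points and their
    lengths at most one, so if they meet they are equal, or meet in a common end; with equal base
    points but different lengths one of them is a point. *)
Lemma segments_meet w1 w2 w3 v1 v2 v3 k l k' l' :
  (w1 <= 1)%N -> (w2 <= 1)%N -> (w3 <= 1)%N ->
  (v1 <= 1)%N -> (v2 <= 1)%N -> (v3 <= 1)%N ->
  [\/ [/\ k = k', w1 = 0, w3 = 0, v1 = 0 & v3 = 0]%N,
      [/\ l = l', w1 = 0, w2 = 0, v1 = 0 & v2 = 0]%N |
      [/\ k + l = k' + l', w2 = 0%N, w3 = 0%N, v2 = 0%N & v3 = 0%N]] ->
  let S := (0%N, w1, w2, w3, k, l) in let S' := (0%N, v1, v2, v3, k', l') in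
  cell R S `&` cell R S' !=set0 -> exists L,
  [/\ L \in faces S, L \in faces S' & cell R S `&` cell R S' = cell R L].
Proof.
move=> w1_ w2_ w3_ v1_ v2_ v3_ dir S S' [p [pS pS']].
have [S1 S2] := segment_ends w1 w2 w3 k l.
have [S1' S2'] := segment_ends v1 v2 v3 k' l'.
have SI : S = S' ->
    exists L, [/\ L \in faces S, L \in faces S' & cell R S `&` cell R S' = cell R L].
  by move=> <-; exists S; rewrite setIid mem_head.
have VI L L' : L \in faces S -> L' \in faces S' -> L = L' ->
    cell R S `&` cell R S' = cell R L ->
    exists L, [/\ L \in faces S, L \in faces S' & cell R S `&` cell R S' = cell R L].
  by move=> LS LS' E ES; exists L; rewrite {2}E.
have le_int (a b : int) (r : R) : a%:~R <= r -> r <= b%:~R -> a <= b.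
  by move=> ar rb; rewrite -(ler_int R); exact: le_trans rb.
have inter (L1 L2 L3 : label) :
  (forall x y : R, cell R L1 (pt x y) -> cell R L2 (pt x y) -> cell R L3 (pt x y)) ->
  (forall x y : R, cell R L3 (pt x y) -> cell R L1 (pt x y) /\ cell R L2 (pt x y)) ->
  cell R L1 `&` cell R L2 = cell R L3.
  move=> h1 h2; apply/seteqP; split; elim/pt_ind=> x y; [by case; exact: h1 | exact: h2].
have := (ler0n R w1, ler0n R w2, ler0n R w3, ler0n R v1, ler0n R v2, ler0n R v3).
move=> [[[[[w10 w20] w30] v10] v20] v30].
case: dir.
- move=> [? ? ? ? ?]; subst k' w1 w3 v1 v3.
  have h1 : l - w2%:Z <= l'.
    by apply: (le_int _ _ p.2); move: pS pS'; clear;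
    elim/pt_ind: p => x y [/= ? ? ?] [/= ? ? ?]; lra.
  have h2 : l' - v2%:Z <= l.
    by apply: (le_int _ _ p.2); move: pS pS'; clear;
    elim/pt_ind: p => x y [/= ? ? ?] [/= ? ? ?]; lra.
  have [ll|[ll|ll]] : l < l' \/ l' < l \/ l = l' by clear; lia.
  + have ? : l' = l + v2%:Z by lia.
    subst l'; apply: (VI _ _ S2 S1'); first by clear; apply: label_eq; lia.
    apply: inter => x y; clear -w10 w20 w30 v10 v20 v30; move=> [/= ? ? ?];
      by [move=> [/= ? ? ?]; do !split => /=; lra | do !split => /=; lra].
  + have ? : l' = l - w2%:Z by lia.
    subst l'; apply: (VI _ _ S1 S2'); first by clear; apply: label_eq; lia.
    apply: inter => x y; clear -w10 w20 w30 v10 v20 v30; move=> [/= ? ? ?];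
      by [move=> [/= ? ? ?]; do !split => /=; lra | do !split => /=; lra].
  + subst l'; have [?|wv] := eqVneq w2 v2; first by subst v2; exact: SI.
    apply: (VI _ _ S2 S2'); first by clear; apply: label_eq; lia.
    have w0 : (w2 = 0 \/ v2 = 0)%N by clear -w2_ v2_ wv; lia.
    apply: inter => x y; clear -w0 w10 w20 w30 v10 v20 v30; case: w0 => ?; subst;
      move=> [/= ? ? ?]; [move=> [/= ? ? ?]|move=> [/= ? ? ?]| |]; do !split => /=; lra.
- move=> [? ? ? ? ?]; subst l' w1 w2 v1 v2.
  have h1 : k' <= k + w3%:Z.
    by apply: (le_int _ _ p.1); move: pS pS'; clear;
    elim/pt_ind: p => x y [/= ? ? ?] [/= ? ? ?]; lra.
  have h2 : k <= k' + v3%:Z.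
    by apply: (le_int _ _ p.1); move: pS pS'; clear;
    elim/pt_ind: p => x y [/= ? ? ?] [/= ? ? ?]; lra.
  have [ll|[ll|ll]] : k < k' \/ k' < k \/ k = k' by clear; lia.
  + have ? : k' = k + w3%:Z by lia.
    subst k'; apply: (VI _ _ S1 S2'); first by clear; apply: label_eq; lia.
    apply: inter => x y; clear -w10 w20 w30 v10 v20 v30; move=> [/= ? ? ?];
      by [move=> [/= ? ? ?]; do !split => /=; lra | do !split => /=; lra].
  + have ? : k' = k - v3%:Z by lia.
    subst k'; apply: (VI _ _ S2 S1'); first by clear; apply: label_eq; lia.
    apply: inter => x y; clear -w10 w20 w30 v10 v20 v30; move=> [/= ? ? ?];
      by [move=> [/= ? ? ?]; do !split => /=; lra | do !split => /=; lra].
  + subst k'; have [?|wv] := eqVneq w3 v3; first by subst v3; exact: SI.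
    apply: (VI _ _ S2 S2'); first by clear; apply: label_eq; lia.
    have w0 : (w3 = 0 \/ v3 = 0)%N by clear -w3_ v3_ wv; lia.
    apply: inter => x y; clear -w0 w10 w20 w30 v10 v20 v30; case: w0 => ?; subst;
      move=> [/= ? ? ?]; [move=> [/= ? ? ?]|move=> [/= ? ? ?]| |]; do !split => /=; lra.
- move=> [? ? ? ? ?]; have ? : l' = k + l - k' by lia.
  subst l' w2 w3 v2 v3.
  have h1 : k - w1%:Z <= k'.
    by apply: (le_int _ _ p.1); move: pS pS'; clear;
    elim/pt_ind: p => x y [/= ? ? ?] [/= ? ? ?]; lra.
  have h2 : k' - v1%:Z <= k.
    by apply: (le_int _ _ p.1); move: pS pS'; clear;
    elim/pt_ind: p => x y [/= ? ? ?] [/= ? ? ?]; lra.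
  have [ll|[ll|ll]] : k < k' \/ k' < k \/ k = k' by clear; lia.
  + have ? : k' = k + v1%:Z by lia.
    subst k'; apply: (VI _ _ S1 S2'); first by clear; apply: label_eq; lia.
    apply: inter => x y; clear -w10 w20 w30 v10 v20 v30; move=> [/= ? ? ?];
      by [move=> [/= ? ? ?]; do !split => /=; lra | do !split => /=; lra].
  + have ? : k' = k - w1%:Z by lia.
    subst k'; apply: (VI _ _ S2 S1'); first by clear; apply: label_eq; lia.
    apply: inter => x y; clear -w10 w20 w30 v10 v20 v30; move=> [/= ? ? ?];
      by [move=> [/= ? ? ?]; do !split => /=; lra | do !split => /=; lra].
  + subst k'; have [?|wv] := eqVneq w1 v1.
      by subst v1; apply: SI; clear; apply: label_eq; lia.
    apply: (VI _ _ S1 S1'); first by clear; apply: label_eq; lia.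
    have w0 : (w1 = 0 \/ v1 = 0)%N by clear -w1_ v1_ wv; lia.
    apply: inter => x y; clear -w0 w10 w20 w30 v10 v20 v30; case: w0 => ?; subst;
      move=> [/= ? ? ?]; [move=> [/= ? ? ?]|move=> [/= ? ? ?]| |]; do !split => /=; lra.
Qed.

End CellGeometry.

Section CellMeet.
Variable R : realType.
Implicit Types (P Q F : set (plane R)) (p q a : plane R) (L : label).

(** Separation by a lattice line: a line of constant x, y or x + y has the first cell on its lower
    side and the second on its upper side. *)
Definition below L L' : bool :=
  let: (c, w1, w2, w3, k, l) := L in let: (c', w1', w2', w3', k', l') := L' in
  [|| k + w3%:Z + c%:Z <= k' - w1'%:Z, l + w1%:Z + c%:Z <= l' - w2'%:Z |
      k + l + w3%:Z + c%:Z <= k' + l' - w2'%:Z].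

(** These sums are the lengths that occur in [edges], so no edge is longer than one lattice step. *)
Lemma valid_le1 c w1 w2 w3 k l : valid (c, w1, w2, w3, k, l) ->
  [/\ c + w1 <= 1, c + w2 <= 1 & c + w3 <= 1]%N.
Proof. by move=> /and5P[? ? ? ? /orP[] /eqP ?]; split; lia. Qed.

(** If separated cells meet, the supporting lines facing each other coincide, and the intersection
    is that of the two edges on this line. Those edges have opposite positions in [edges]: 0 and 3,
    2 and 5, or 1 and 4. *)
Lemma cell_meet_below L L' : valid L -> valid L' -> below L L' ->
  cell R L `&` cell R L' !=set0 -> exists M,
  [/\ M \in faces L, M \in faces L' & cell R L `&` cell R L' = cell R M].
Proof.
move=> vL vL' LL' ne.
have via i j : (i < 6)%N -> (j < 6)%N ->
    cell R L `&` cell R L' = cell R (nth L (edges L) i) `&` cell R (nth L' (edges L') j) ->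
  (cell R (nth L (edges L) i) `&` cell R (nth L' (edges L') j) !=set0 -> exists M,
  [/\ M \in faces (nth L (edges L) i), M \in faces (nth L' (edges L') j) &
    cell R (nth L (edges L) i) `&` cell R (nth L' (edges L') j) = cell R M]) ->
  exists M, [/\ M \in faces L, M \in faces L' & cell R L `&` cell R L' = cell R M].
  move=> i6 j6 E; rewrite -E => /(_ ne)[M [Mi Mj ME]]; exists M; split=> //.
    exact: faces_trans (edges_faces i L) Mi.
  exact: faces_trans (edges_faces j L') Mj.
have le_int (a b : int) (r : R) : a%:~R <= r -> r <= b%:~R -> a <= b.
  by move=> ar rb; rewrite -(ler_int R); exact: le_trans rb.
have inter (L1 L2 L3 L4 : label) :
  (forall x y : R, cell R L1 (pt x y) -> cell R L2 (pt x y) ->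
    cell R L3 (pt x y) /\ cell R L4 (pt x y)) ->
  (forall x y : R, cell R L3 (pt x y) -> cell R L4 (pt x y) ->
    cell R L1 (pt x y) /\ cell R L2 (pt x y)) ->
  cell R L1 `&` cell R L2 = cell R L3 `&` cell R L4.
  by move=> h1 h2; apply/seteqP; split; elim/pt_ind=> x y; case; [exact: h1 | exact: h2].
case: ne => p [].
case: L vL LL' via => [[[[[c w1] w2] w3] k] l] vL.
case: L' vL' => [[[[[c' w1'] w2'] w3'] k'] l'] vL' LL' via.
have := (ler0n R w1, ler0n R w2, ler0n R w3, ler0n R c).
move=> [[[H H0] H1] H2].
have := (ler0n R w1', ler0n R w2', ler0n R w3', ler0n R c').
move=> [[[H3 H4] H5] H6].
elim/pt_ind: p => x y [/= hx hy hz] [/= hx' hy' hz'].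
case: (valid_le1 vL) (valid_le1 vL') => u1 u2 u3 [u1' u2' u3'].
case/or3P: LL' => le.
- have E : k' = k + w3%:Z + c%:Z + w1'%:Z.
    suff : k' - w1'%:Z <= k + w3%:Z + c%:Z by clear -le; lia.
    by apply: (le_int _ _ x); lra.
  subst k'.
  apply: (via 0%N 3%N) => // [|]; last first.
    clear -u1 u2 u3 u1' u2' u3'; rewrite /=; apply: segments_meet; try lia.
    apply: Or31; split=> //; lia.
  apply: inter => u v; clear -H H0 H1 H2 H3 H4 H5 H6;
    move=> [/= ? ? ?] [/= ? ? ?]; do !split => /=; lra.
- have E : l' = l + w1%:Z + c%:Z + w2'%:Z.
    suff : l' - w2'%:Z <= l + w1%:Z + c%:Z by clear -le; lia.
    by apply: (le_int _ _ y); lra.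
  subst l'.
  apply: (via 2%N 5%N) => // [|]; last first.
    clear -u1 u2 u3 u1' u2' u3'; rewrite /=; apply: segments_meet; try lia.
    apply: Or32; split=> //; lia.
  apply: inter => u v; clear -H H0 H1 H2 H3 H4 H5 H6;
    move=> [/= ? ? ?] [/= ? ? ?]; do !split => /=; lra.
- have E : l' = k + l + w3%:Z + c%:Z + w2'%:Z - k'.
    suff : k' + l' - w2'%:Z <= k + l + w3%:Z + c%:Z by clear -le; lia.
    by apply: (le_int _ _ (x + y)); lra.
  subst l'.
  apply: (via 1%N 4%N) => // [|]; last first.
    clear -u1 u2 u3 u1' u2' u3'; rewrite /=; apply: segments_meet; try lia.
    apply: Or33; split=> //; lia.
  apply: inter => u v; clear -H H0 H1 H2 H3 H4 H5 H6;
    move=> [/= ? ? ?] [/= ? ? ?]; do !split => /=; lra.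
Qed.

End CellMeet.

(** * Complexes of cells *)

Section Complexes.
Variable R : realType.
Implicit Types (P Q F : set (plane R)) (p q a : plane R) (L : label).

Lemma face_sub P F : face P F -> F `<=` P.
Proof. by case=> a -> p []. Qed.

Lemma face_refl P : face P P.
Proof.
exists 0; apply/seteqP; split=> p; last by case.
by move=> Pp; split=> // q _; rewrite /dotp !mul0r.
Qed.

(** The linear form that cuts G out of P attains its maximum over P at points of F, hence cuts the
    intersection out of F. *)
Lemma face_setI P F G : face P F -> face P G -> F `&` G !=set0 -> face F (F `&` G).
Proof.
move=> fF [b GE] [g [Fg Gg]]; exists b; apply/seteqP; split=> p.
  move=> [Fp]; rewrite GE => -[_ bp]; split=> // q Fq.
  exact/bp/(face_sub fF).
move=> [Fp bp]; split=> //; rewrite GE; split; first exact: face_sub fF _ Fp.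
move=> q Pq; apply: le_trans (bp g Fg).
by move: Gg; rewrite GE => -[_]; exact.
Qed.

(** The common face of the two cells, intersected with G, is a face of that common face and so of
    [cell R L]; intersecting with F then gives a face of F. *)
Lemma faces_meet L L' F G : face (cell R L) F -> face (cell R L') G ->
  face (cell R L) (cell R L `&` cell R L') ->
  face (cell R L') (cell R L `&` cell R L') ->
  F `&` G !=set0 -> face F (F `&` G).
Proof.
move=> fF fG fL fL' ne; have FE : F `&` G = F `&` (cell R L `&` cell R L' `&` G).
  apply/seteqP; split=> p [Fp]; last by case.
  move=> Gp; split=> //; split=> //; split; first exact: face_sub fF _ Fp.
  exact: face_sub fG _ Gp.
rewrite FE in ne *; apply: (face_setI fF) => //.
apply: (face_trans fL); apply: (face_setI fL' fG).
by case: ne => p [_ hp]; exists p.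
Qed.

Definition complex_of (s : seq label) : set (set (plane R)) :=
  [set F | exists2 L, L \in s & face (cell R L) F].

Lemma valid_faces L L' : valid L -> L' \in faces L -> valid L'.
Proof.
case: L => [[[[[c w1] w2] w3] k] l] v.
have [h1 h2 h3] := valid_le1 v; move: v => /and5P[c1 v1 v2 v3 cw].
rewrite !inE => /orP[/eqP->|]; first by rewrite /= c1 v1 v2 v3.
do 11?[case/orP]; move=> /eqP -> /=; lia.
Qed.

(** Pairwise separation makes the listed cells meet in common faces, and [faces_meet] passes this on
    to all their faces. *)
Lemma polyhedral_complex_of (s : seq label) : all valid s ->
  (forall L L', L \in s -> L' \in s -> [\/ L = L', below L L' | below L' L]) ->
  polyhedral_complex (complex_of s).
Proof.
move=> /allP sv sb; split.
- apply: (@sub_finite_set _ _ (cell R @` [set` flatten (map faces s)]));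
    last exact/finite_image/finite_seq.
  move=> F [L Ls /face_cellP[L' LL' ->]]; exists L' => //=.
  by apply/flatten_mapP; exists L.
- move=> F [L Ls /face_cellP[L' LL' ->]].
  exact/polytope_cell/(valid_faces (sv _ Ls)).
- move=> P F [L Ls fP] fF; exists L => //; exact: face_trans fF.
- move=> P Q [L Ls fP] [L' L's fQ] ne.
  have ne' : cell R L `&` cell R L' !=set0.
    case: ne => p [Pp Qp]; exists p.
    by split; [exact: face_sub fP _ Pp | exact: face_sub fQ _ Qp].
  have [fL fL'] : face (cell R L) (cell R L `&` cell R L') /\
      face (cell R L') (cell R L `&` cell R L').
    have [<-|b|b] := sb _ _ Ls L's.
    + by rewrite setIid; split; exact: face_refl.
    + have [M [ML ML' ->]] := cell_meet_below (sv _ Ls) (sv _ L's) b ne'.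
      by split; exact: faces_face.
    + rewrite setIC in ne' *.
      have [M [ML ML' ->]] := cell_meet_below (sv _ L's) (sv _ Ls) b ne'.
      by split; exact: faces_face.
  split; first exact: (faces_meet fP fQ).
  rewrite setIC in ne *; rewrite setIC in fL fL'.
  exact: (faces_meet fQ fP).
Qed.

(** A linear form equal at three points that are not collinear is zero, so its maximizers are all of
    P. *)
Lemma face_full P F (x y d : R) : d != 0 -> face P F -> F (pt x y) ->
  F (pt (x + d) y) -> F (pt x (y + d)) -> F = P.
Proof.
move=> d0 [a FE]; rewrite FE => -[P0 m0] [P1 m1] [P2 m2].
have := (m0 _ P1, m1 _ P0, m0 _ P2, m2 _ P0); rewrite /dotp /=.
move=> [[[h1 h2] h3] h4].
have a1 : a.1 = 0 by apply: (mulIf d0); lra.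
have a2 : a.2 = 0 by apply: (mulIf d0); lra.
apply/seteqP; split=> p; first by case.
by move=> Pp; split=> // q _; rewrite /dotp a1 a2 !mul0r.
Qed.

(* The upward (e = false) or downward (e = true) unit lattice triangle inscribed
   in the square [i, i + 1] x [j, j + 1]. *)
Definition covers (e : bool) L (i j : int) : bool :=
  let: (c, w1, w2, w3, k, l) := L in
  [&& k - w1%:Z <= i, i + 1 <= k + w3%:Z + c%:Z,
      l - w2%:Z <= j, j + 1 <= l + w1%:Z + c%:Z,
      k + l - w2%:Z <= i + j + e%:Z & i + j + e%:Z + 1 <= k + l + w3%:Z + c%:Z].

Definition centroid (e : bool) (i j : int) : plane R :=
  pt (i%:~R + (1 + e%:R) / 3%:R) (j%:~R + (1 + e%:R) / 3%:R).

(** The bounds of a cell are integers, while x, y and x + y are not integers at the centroid; each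
    bound therefore rounds to one valid on the whole triangle. *)
Lemma cell_centroid e L i j : cell R L (centroid e i j) -> covers e L i j.
Proof.
have le_ (a b : int) (r : R) : r < 1 -> a%:~R <= b%:~R + r -> a <= b.
  by move=> r1 ab; rewrite -ltzD1 -(ltr_int R) intrD; apply: le_lt_trans ab _; lra.
have ge_ (a b : int) (r : R) : 0 < r -> b%:~R + r <= a%:~R -> b + 1 <= a.
  by move=> r1 ab; rewrite lezD1 -(ltr_int R); apply: lt_le_trans ab; lra.
case: L => [[[[[c w1] w2] w3] k] l] [/= hx hy hz].
have e01 : (0 <= e%:R :> R) && (e%:R <= 1 :> R) by case: (e); rewrite /= ?lexx ?ler01.
set r := (1 + e%:R) / 3%:R in hx hy hz.
have r0 : 0 < r < 1 by rewrite /r; lra.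
have ez : r + r = e%:R + (2 - e%:R) / 3 by rewrite /r; field.
apply/and5P; split; last (apply/andP; split).
- by apply: (le_ _ _ r); lra.
- by apply: (ge_ _ _ r); lra.
- by apply: (le_ _ _ r); lra.
- by apply: (ge_ _ _ r); lra.
- by apply: (le_ _ _ ((2 - e%:R) / 3)); lra.
- by apply: (ge_ _ _ ((2 - e%:R) / 3)); lra.
Qed.

Definition triangle_vertices (e : bool) (i j : int) : set (plane R) :=
  [set pt (i + e)%:~R (j + e)%:~R; pt (i + 1 - e%:Z)%:~R (j + e)%:~R;
       pt (i + e)%:~R (j + 1 - e%:Z)%:~R].

Lemma covers_cell e L i j : covers e L i j -> triangle_vertices e i j `<=` cell R L.
Proof.
case: L => [[[[[c w1] w2] w3] k] l] /and5P[h1 h2 h3 h4 /andP[h5 h6]].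
have e01 : (0 <= e%:R :> R) && (e%:R <= 1 :> R) by case: (e); rewrite /= ?lexx ?ler01.
move: h1 h2 h3 h4 h5 h6; rewrite -!(ler_int R) => h1 h2 h3 h4 h5 h6.
by case: e e01 h5 h6 => /= ? ? ? _ [[]|] ->; split=> /=; lra.
Qed.

Lemma unit_triangle_face e P F i j : face P F -> triangle_vertices e i j `<=` F ->
  F = P.
Proof.
move=> fF VF.
have c1 : F (pt (i + e)%:~R (j + e)%:~R) by apply: VF; left; left.
have c2 : F (pt (i + 1 - e%:Z)%:~R (j + e)%:~R) by apply: VF; left; right.
have c3 : F (pt (i + e)%:~R (j + 1 - e%:Z)%:~R) by apply: VF; right.
(* The legs leave the right-angled corner in the positive directions for an upward triangle and in
   the negative ones for a downward triangle, so the step is 1 or -1. *)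
apply: (@face_full _ _ (i + e)%:~R (j + e)%:~R (1 - e%:R *+ 2)) => //.
- by case: (e); rewrite /= ?subr0 ?oner_eq0 // -subr_eq0; lra.
- by congr (F (pt _ _)): c2; case: (e) => /=; rewrite !(intrD, intrB); ring.
- by congr (F (pt _ _)): c3; case: (e) => /=; rewrite !(intrD, intrB); ring.
Qed.

(** The inclusion is tested at four points at which, together, all six bounds of the smaller cell
    are attained. *)
Lemma cell_sub L L' : cell R L `<=` cell R L' ->
  let: (c, w1, w2, w3, k, l) := L in let: (c', w1', w2', w3', k', l') := L' in
  [/\ [/\ k' - w1'%:Z <= k - w1%:Z, k + w3%:Z + c%:Z <= k' + w3'%:Z + c'%:Z,
          l' - w2'%:Z <= l - w2%:Z & l + w1%:Z + c%:Z <= l' + w1'%:Z + c'%:Z],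
      k' + l' - w2'%:Z <= k + l - w2%:Z &
      k + l + w3%:Z + c%:Z <= k' + l' + w3'%:Z + c'%:Z].
Proof.
case: L => [[[[[c w1] w2] w3] k] l]; case: L' => [[[[[c' w1'] w2'] w3'] k'] l'].
have := (ler0n R w1, ler0n R w2, ler0n R w3, ler0n R c).
move=> [[[? ?] ?] ?] LL'.
have [] : cell R (c', w1', w2', w3', k', l') (pt (k%:~R + w3%:R + c%:R) l%:~R).
  by apply: LL'; split=> /=; lra.
move=> /= ? _ ?.
have [] : cell R (c', w1', w2', w3', k', l')
    (pt (k%:~R - w1%:R) (l%:~R - w2%:R + w1%:R)).
  by apply: LL'; split=> /=; lra.
move=> /= ? _ ?.
have [/= _ ? _] : cell R (c', w1', w2', w3', k', l')
    (pt (k%:~R + w3%:R - w1%:R) (l%:~R + w1%:R + c%:R)).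
  by apply: LL'; split=> /=; lra.
have [/= _ ? _] : cell R (c', w1', w2', w3', k', l') (pt k%:~R (l%:~R - w2%:R)).
  by apply: LL'; split=> /=; lra.
by clear LL'; split; [split|..]; rewrite -(ler_int R); lra.
Qed.

(** Equal cells have equal widths in x, y and x + y. The sum 3c + 2(w1 + w2 + w3) of the widths has
    the parity of c, and with c known the widths determine the weights. *)
Lemma cell_inj : {in valid &, injective (cell R)}.
Proof.
move=> L L' v v' E.
have : cell R L `<=` cell R L' by rewrite E.
have : cell R L' `<=` cell R L by rewrite E.
move=> /cell_sub + /cell_sub; clear E; move: v v'.
case: L => [[[[[c w1] w2] w3] k] l]; case: L' => [[[[[c' w1'] w2'] w3'] k'] l'].
move=> v v' [[? ? ? ?] ? ?] [[? ? ? ?] ? ?].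
have ? : (w1 + w3 + c = w1' + w3' + c')%N by lia.
have ? : (w1 + w2 + c = w1' + w2' + c')%N by lia.
have ? : (w2 + w3 + c = w2' + w3' + c')%N by lia.
move: v v'; rewrite !unfold_in /= => v v'.
have ? : c = c' by lia.
have [? ? ?] : [/\ w1 = w1', w2 = w2' & w3 = w3'] by split; lia.
by apply: label_eq => //; lia.
Qed.

End Complexes.

(** * Counting unit triangles *)

Section Counting.
Local Open Scope nat_scope.
Variable n : nat.

(** Summing over a square rather than over the triangle lets an index shift change the sum by
    boundary rows only. *)
Definition grid_sum (f : nat -> nat -> nat) := \sum_(i < n.+1) \sum_(j < n.+1) f i j.

Lemma eq_grid_sum f g : (forall i j, f i j = g i j) -> grid_sum f = grid_sum g.
Proof. by move=> fg; apply: eq_bigr => i _; apply: eq_bigr => j _. Qed.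

Lemma leq_grid_sum f g : (forall i j, f i j <= g i j) -> grid_sum f <= grid_sum g.
Proof. by move=> fg; apply: leq_sum => i _; apply: leq_sum => j _. Qed.

Lemma grid_sumD f g : grid_sum (fun i j => f i j + g i j) = grid_sum f + grid_sum g.
Proof. by rewrite -big_split; apply: eq_bigr => i _; rewrite -big_split. Qed.

Lemma sum_recl_recr N (F : nat -> nat) :
  F 0 + \sum_(i < N) F i.+1 = \sum_(i < N) F i + F N.
Proof.
rewrite -(big_mkord xpredT F) -(big_mkord xpredT (fun i => F i.+1)).
by rewrite -big_nat_recl // -big_nat_recr.
Qed.

Lemma grid_sum_shift1 f : (forall j, f 0 j = 0) -> (forall j, f n.+1 j = 0) ->
  grid_sum (fun i j => f i.+1 j) = grid_sum f.
Proof.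
move=> f0 fn; have := sum_recl_recr n.+1 (fun i => \sum_(j < n.+1) f i j).
by rewrite big1 // [X in _ = _ + X]big1 // addn0.
Qed.

Lemma grid_sum_shift2 f : (forall i, f i 0 = 0) -> (forall i, f i n.+1 = 0) ->
  grid_sum (fun i j => f i j.+1) = grid_sum f.
Proof.
move=> f0 fn; rewrite /grid_sum exchange_big [RHS]exchange_big.
exact: (@grid_sum_shift1 (fun i j => f j i)).
Qed.

Lemma leq_grid_sum_shift1 f : (forall j, f n.+1 j = 0) ->
  grid_sum (fun i j => f i.+1 j) <= grid_sum f.
Proof.
move=> fn; have := sum_recl_recr n.+1 (fun i => \sum_(j < n.+1) f i j).
by rewrite [X in _ = _ + X]big1 // addn0 /grid_sum => <-; exact: leq_addl.
Qed.

Lemma leq_grid_sum_shift2 f : (forall i, f i n.+1 = 0) ->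
  grid_sum (fun i j => f i j.+1) <= grid_sum f.
Proof.
move=> fn; rewrite /grid_sum exchange_big [leqRHS]exchange_big.
exact: (@leq_grid_sum_shift1 (fun i j => f j i)).
Qed.

Lemma sum_lt N q : \sum_(j < N) (j < q) = minn N q.
Proof. by elim: N => [|N IH]; rewrite ?big_ord0 ?big_ord_recr /= ?IH; lia. Qed.

Lemma sum_eq N q : \sum_(j < N) (j == q :> nat) <= 1.
Proof.
suff -> : \sum_(j < N) (j == q :> nat) = (q < N) by case: (_ < _).
by elim: N => [|N IH]; rewrite ?big_ord0 ?big_ord_recr /= ?IH; lia.
Qed.

Lemma grid_sum_lt m : m <= n.+1 -> (grid_sum (fun i j => i + j < m)).*2 = m * m.+1.
Proof.
(* Row i holds m - i points; the second summand is twice the number of points in the rows from N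
   on. *)
move=> mn; have E N : (\sum_(i < N) (m - i)).*2 + (m - N) * (m - N).+1 = m * m.+1.
  elim: N => [|N IH]; first by rewrite big_ord0 subn0.
  rewrite big_ord_recr /= -IH doubleD -addnA; congr (_ + _).
  have [mN|Nm] := leqP m N.
    by have [-> ->] : m - N = 0 /\ m - N.+1 = 0 by lia.
  have -> : m - N = (m - N.+1).+1 by lia.
  by rewrite !mulSn !mulnS; lia.
rewrite -(E n.+1); have -> : m - n.+1 = 0 by lia.
rewrite mul0n addn0; congr _.*2; apply: eq_bigr => i _.
rewrite (eq_bigr (fun j : 'I_n.+1 => (j < m - i : nat))) => [|j _]; last by congr nat_of_bool; lia.
by rewrite sum_lt; lia.
Qed.

(* t, a, b, g, h count the cells of the five two-dimensional types with given
   translation vector: triangles, P_{0,1,0,1}, P_{0,0,1,1}, P_{0,1,1,0} and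
   hexagons. *)
Variables t a b g h : nat -> nat -> nat.
(** Each unit triangle of Delta_n lies in exactly one cell, and one outside Delta_n in none. The
    summands are the cells that cover the upward triangle, resp. in [downE] the downward triangle,
    at (i, j). *)
Hypothesis upE : forall i j,
  t i j + a i j + b i j.+1 + g i.+1 j + h i j + h i.+1 j + h i j.+1 = (i + j < n).
Hypothesis downE : forall i j,
  a i.+1 j + b i j.+1 + g i.+1 j.+1 + h i.+1 j + h i j.+1 + h i.+1 j.+1 =
  (i + j.+1 < n).
(** This and the next five conditions exclude cells that cross a coordinate axis. *)
Hypothesis a0 : forall j, a 0 j = 0.
Hypothesis b0 : forall i, b i 0 = 0.
Hypothesis g01 : forall j, g 0 j = 0.
Hypothesis g02 : forall i, g i 0 = 0.
Hypothesis h01 : forall j, h 0 j = 0.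
Hypothesis h02 : forall i, h i 0 = 0.

Let p := grid_sum a + grid_sum b + grid_sum g.

(** Here [upE] has right-hand side 0, so all its summands vanish; this disposes of the boundary rows
    in the index shifts. *)
Let far i j : n <= i + j ->
  [/\ a i j = 0, b i j.+1 = 0, g i.+1 j = 0, t i j = 0 & h i j = 0].
Proof. by move=> ij; have := upE i j; split; lia. Qed.

(** A triangular cell or a parallelogram contains one upward triangle and a hexagon three. For
    downward triangles the numbers are 0, 1 and 3. *)
Let grid_sum_up : grid_sum t + p + 3 * grid_sum h = grid_sum (fun i j => i + j < n).
Proof.
rewrite -(eq_grid_sum upE) !grid_sumD.
rewrite (grid_sum_shift2 (f := b)) ?(grid_sum_shift1 (f := g)) ?(grid_sum_shift1 (f := h))
        ?(grid_sum_shift2 (f := h)) //; first by rewrite /p; lia.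
- by move=> i; case: (@far i n.+1) => //; lia.
- by move=> j; case: (@far n.+1 j) => //; lia.
- by move=> j; case: (@far n j) => //; lia.
- by move=> i; case: (@far i n) => //; lia.
Qed.

Let grid_sum_down : p + 3 * grid_sum h = grid_sum (fun i j => i + j < n.-1).
Proof.
rewrite [RHS](eq_grid_sum (g := fun i j => i + j.+1 < n)) => [|i j]; last by lia.
have an j : a n.+1 j = 0 by case: (@far n.+1 j) => //; lia.
have bn i : b i n.+1 = 0 by case: (@far i n) => //; lia.
have g1n j : g n.+1 j = 0 by case: (@far n j) => //; lia.
have g2n i : g i n.+1 = 0.
  by case: i => [|i]; [exact: g01 | case: (@far i n.+1) => //; lia].
have h1n j : h n.+1 j = 0 by case: (@far n.+1 j) => //; lia.
have h2n i : h i n.+1 = 0 by case: (@far i n.+1) => //; lia.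
rewrite -(eq_grid_sum downE) !grid_sumD (grid_sum_shift1 a0 an) (grid_sum_shift2 b0 bn).
rewrite (grid_sum_shift1 (f := fun i j => g i j.+1)) // (grid_sum_shift2 g02 g2n).
rewrite (grid_sum_shift1 (f := fun i j => h i j.+1)) // (grid_sum_shift2 h02 h2n).
by rewrite (grid_sum_shift1 h01 h1n) /p; lia.
Qed.

(** The difference of the two counts is n(n+1)/2 - n(n-1)/2. *)
Let grid_sum_t : 0 < n -> grid_sum t = n.
Proof.
move=> n0; have := grid_sum_up; have := grid_sum_down.
have := grid_sum_lt (leqnSn n); have : n.-1 <= n.+1 by lia.
move=> /grid_sum_lt; rewrite prednK // => e1 e2 e3 e4.
have : n * n.+1 = n.-1 * n + n.*2 by case: n n0 => // m _; rewrite /= !mulSn !mulnS; lia.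
lia.
Qed.

(* The upward triangles around an interior vertex are as many as the downward
   ones, and the cells having an obtuse angle at the vertex, or containing it in
   their interior, contribute equally to both. *)
Let vertex_le i j : i + j.+2 < n ->
  t i.+1 j.+1 + t i j.+1 + t i.+1 j <= g i.+1 j.+2 + a i.+2 j + b i j.+1.
Proof.
(* These are the three upward triangles at the vertex (i+1, j+1); the next line takes the three
   downward ones. Subtracting the two sums cancels all hexagons. *)
move=> ij; have := (upE i.+1 j.+1, upE i j.+1, upE i.+1 j).
have := (downE i j.+1, downE i.+1 j, downE i j).
have -> : (i.+1 + j.+1 < n) = true by lia.
have -> : (i + j.+1 < n) = true by lia.
have -> : (i.+1 + j < n) = true by lia.
have -> : (i + j.+2 < n) = true by lia.
move=> [[d1 d2] d3] [[u1 u2] u3]; lia.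
Qed.

Let grid_sum_pointed x y : grid_sum (fun i j => (i == x) && (j == y)) <= 1.
Proof.
rewrite /grid_sum (eq_bigr (fun i : 'I_n.+1 => (i == x :> nat) * \sum_(j < n.+1) (j == y :> nat))).
  by rewrite -big_distrl /= -[1]muln1; apply: leq_mul; exact: sum_eq.
by move=> i _; rewrite big_distrr; apply: eq_bigr => j _; case: eqP; case: eqP.
Qed.

(* Only the triangles in the corners of Delta_n have no interior vertex. *)
Let corner_loss : grid_sum t <= 3 +
  grid_sum (fun i j => (i + j.+2 < n) * (t i.+1 j.+1 + t i j.+1 + t i.+1 j)).
Proof.
have t1 i j : t i j <= 1 by have := upE i j; case: (_ < n) => /=; lia.
have t0 i j : n <= i + j -> t i j = 0 by move=> /far[].
have inn i j : t i.+1 j.+1 <= (i + j.+2 < n) * t i.+1 j.+1.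
  have [ij|ij] := ltnP (i + j.+2) n; first by rewrite mul1n.
  by rewrite t0 //; lia.
(* A triangle on the left side, based at (0, j+1), has the interior vertex (1, j+1) unless j + 2 =
   n, when it sits in the top corner. The bottom side is symmetric. *)
have lft i j : (i == 0) * t i j.+1 <= (i + j.+2 < n) * t i j.+1 + ((i == 0) && (j == n.-2)).
  case: i => [|i] //=; rewrite mul1n; have [ij|ij] := ltnP (0 + j.+2) n; first by lia.
  have [->|jn] := eqVneq j n.-2; first by have := t1 0 (n.-2).+1; lia.
  by rewrite t0 //; lia.
have bot i j : (j == 0) * t i.+1 j <= (i + j.+2 < n) * t i.+1 j + ((i == n.-2) && (j == 0)).
  case: j => [|j] //=; rewrite mul1n; have [ij|ij] := ltnP (i + 2) n; first by lia.
  have [->|jn] := eqVneq i n.-2; first by have := t1 (n.-2).+1 0; lia.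
  by rewrite t0 //; lia.
(* The triangles are sorted by their base vertex: off both axes, on the left side, on the bottom
   side, or at the origin. *)
pose f1 i j := (0 < i) * (0 < j) * t i j.
pose f2 i j := (i == 0) * (0 < j) * t i j.
pose f3 i j := (j == 0) * (0 < i) * t i j.
have split_t : grid_sum t <= grid_sum f1 + grid_sum f2 + grid_sum f3 +
    grid_sum (fun i j => (i == 0) && (j == 0)).
  rewrite -!grid_sumD; apply: leq_grid_sum => -[|i] [|j]; have := t1 0 0;
  by rewrite /f1 /f2 /f3 /= ?mul1n ?mul0n ?addn0 ?add0n; lia.
have E : grid_sum f1 + grid_sum f2 + grid_sum f3 = grid_sum (fun i j => f1 i.+1 j.+1) +
    grid_sum (fun i j => f2 i j.+1) + grid_sum (fun i j => f3 i.+1 j).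
  have z1 i j : [|| i == 0, j == 0 | n <= i + j] -> f1 i j = 0.
    by rewrite /f1; case: i j => [|i] [|j] //= /t0 ->; rewrite muln0.
  have z2 i j : (j == 0) || (n <= i + j) -> f2 i j = 0.
    by rewrite /f2; case: j => [|j] /=; [rewrite muln0 | move=> /t0 ->; rewrite muln0].
  have z3 i j : (i == 0) || (n <= i + j) -> f3 i j = 0.
    by rewrite /f3; case: i => [|i] /=; [rewrite muln0 | move=> /t0 ->; rewrite muln0].
  have -> : grid_sum f2 = grid_sum (fun i j => f2 i j.+1).
    by rewrite grid_sum_shift2 // => i; apply: z2; lia.
  have -> : grid_sum f3 = grid_sum (fun i j => f3 i.+1 j).
    by rewrite grid_sum_shift1 // => i; apply: z3; lia.
  have -> : grid_sum f1 = grid_sum (fun i j => f1 i.+1 j).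
    by rewrite grid_sum_shift1 // => i; apply: z1; lia.
  by rewrite (@grid_sum_shift2 (fun i j => f1 i.+1 j)) // => i; apply: z1; lia.
rewrite {}E in split_t.
have := grid_sum_pointed 0 0; have := grid_sum_pointed 0 n.-2.
have := grid_sum_pointed n.-2 0 => p1 p2 p3.
have le1 : grid_sum (fun i j => f1 i.+1 j.+1) <=
    grid_sum (fun i j => (i + j.+2 < n) * t i.+1 j.+1).
  by apply: leq_grid_sum => i j; rewrite /f1 !mul1n.
have le2 : grid_sum (fun i j => f2 i j.+1) <=
    grid_sum (fun i j => (i + j.+2 < n) * t i j.+1) + grid_sum (fun i j => (i == 0) && (j == n.-2)).
  by rewrite -grid_sumD; apply: leq_grid_sum => i j; rewrite /f2 muln1.
have le3 : grid_sum (fun i j => f3 i.+1 j) <=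
    grid_sum (fun i j => (i + j.+2 < n) * t i.+1 j) + grid_sum (fun i j => (i == n.-2) && (j == 0)).
  by rewrite -grid_sumD; apply: leq_grid_sum => i j; rewrite /f3 muln1.
rewrite [X in _ <= _ + X](eq_grid_sum (g := fun i j => (i + j.+2 < n) * t i.+1 j.+1 +
  (i + j.+2 < n) * t i j.+1 + (i + j.+2 < n) * t i.+1 j)) => [|i j]; last by rewrite !mulnDr.
rewrite !grid_sumD; lia.
Qed.

Lemma parallelogram_bound : 0 < n -> (if 3 %| n then n - 3 else n - 1) <= p.
Proof.
(* [vertex_le] is summed over all interior vertices; on its right-hand side each parallelogram
   occurs for at most one vertex, so the total is at most p. *)
move=> n0; have np : n <= 3 + p.
  rewrite -{1}(grid_sum_t n0); apply: leq_trans corner_loss _; rewrite leq_add2l.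
  pose f i j := g i.+1 j.+2 + a i.+2 j + b i j.+1.
  apply: (@leq_trans (grid_sum f)).
    apply: leq_grid_sum => i j; have [/vertex_le|] := ltnP (i + j.+2) n; last by [].
    by rewrite mul1n.
  have bl : grid_sum (fun i j => b i j.+1) <= grid_sum b.
    by apply: leq_grid_sum_shift2 => i; case: (@far i n) => //; lia.
  have al : grid_sum (fun i j => a i.+2 j) <= grid_sum a.
    apply: (@leq_trans (grid_sum (fun i j => a i.+1 j))).
      apply: (@leq_grid_sum_shift1 (fun i j => a i.+1 j)) => j.
      by case: (@far n.+2 j) => //; lia.
    by apply: leq_grid_sum_shift1 => j; case: (@far n.+1 j) => //; lia.
  have gl : grid_sum (fun i j => g i.+1 j.+2) <= grid_sum g.
    apply: (@leq_trans (grid_sum (fun i j => g i.+1 j.+1))).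
      apply: (@leq_grid_sum_shift2 (fun i j => g i.+1 j.+1)) => i.
      by case: (@far i n.+2) => //; lia.
    apply: (@leq_trans (grid_sum (fun i j => g i.+1 j))).
      apply: (@leq_grid_sum_shift2 (fun i j => g i.+1 j)) => i.
      by case: (@far i n.+1) => //; lia.
    by apply: leq_grid_sum_shift1 => j; case: (@far n j) => //; lia.
  by rewrite !grid_sumD /p; lia.
(* Modulo 3 this makes p congruent to 0 if n = 3q + 1 and to 1 if n = 3q + 2. Either way p is
   congruent to n - 1, which lifts the bound n - 3 to n - 1. *)
have p2 : (p + 3 * grid_sum h).*2 = n.-1 * n.
  by rewrite grid_sum_down grid_sum_lt ?prednK //; lia.
have [q [r [r3 nE]]] : exists q r, r < 3 /\ n = 3 * q + r.
  by exists (n %/ 3), (n %% 3); split; lia.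
case: r r3 nE => [|[|[|//]]] _ nE.
- by rewrite nE addn0 dvdn_mulr //; lia.
- have m : n.-1 * n = 3 * (q * n) by rewrite nE addn1 /= mulnA.
  by rewrite (_ : (3 %| n) = false); [move: m; set u := q * n; lia | lia].
- have m : n.-1 * n = 3 * (q * n + q) + 2.
    have -> : n.-1 = 3 * q + 1 by lia.
    by rewrite mulnDl mul1n -mulnA {2}nE mulnDr addnA.
  by rewrite (_ : (3 %| n) = false); [move: m; set u := q * n; lia | lia].
Qed.
End Counting.

(** * The cells that can cover a given unit triangle *)

Definition tri (i j : int) : label := (1%N, 0%N, 0%N, 0%N, i, j).
Definition par1 (i j : int) : label := (0%N, 1%N, 0%N, 1%N, i, j).
Definition par2 (i j : int) : label := (0%N, 0%N, 1%N, 1%N, i, j).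
Definition par3 (i j : int) : label := (0%N, 1%N, 1%N, 0%N, i, j).
Definition hexa (i j : int) : label := (0%N, 1%N, 1%N, 1%N, i, j).

(** The entries here and in [downs] follow the order of the summands in [upE] and [downE]. *)
Definition ups (i j : int) : seq label :=
  [:: tri i j; par1 i j; par2 i (j + 1); par3 (i + 1) j;
      hexa i j; hexa (i + 1) j; hexa i (j + 1)].

Definition downs (i j : int) : seq label :=
  [:: par1 (i + 1) j; par2 i (j + 1); par3 (i + 1) (j + 1);
      hexa (i + 1) j; hexa i (j + 1); hexa (i + 1) (j + 1)].

Definition covering (e : bool) i j := if e then downs i j else ups i j.

Lemma mem_covering e i j L : L \in covering e i j = valid L && covers e L i j.
Proof.
apply/idP/idP.
  move: L; apply/allP; case: e; rewrite /= !andbA.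
    by do !(apply/andP; split); lia.
  by do !(apply/andP; split); lia.
case: L => [[[[[c w1] w2] w3] k] l] /andP[].
case: c => [|[|c]] //; case: w1 => [|[|w1]] //; case: w2 => [|[|w2]] //;
  case: w3 => [|[|w3]] // _; case: e => cov.
all: try by move: cov => /=; lia.
all: rewrite !inE !xpair_eqE /=; move: cov => /=; lia.
Qed.

Lemma covering_uniq e i j : uniq (covering e i j).
Proof. by case: e; rewrite /= !inE !xpair_eqE /=; lia. Qed.

Lemma count_unique (T : eqType) (a : pred T) (s : seq T) : uniq s ->
  {in s &, forall x y, a x -> a y -> x = y} -> count a s = has a s.
Proof.
elim: s => //= x s IH /andP[xs us] h; rewrite IH //; last first.
  by move=> y z ys zs; apply: h; rewrite inE ?ys ?zs orbT.
case ax: (a x) => //=; case: hasP => // -[y ys ay].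
by move: xs; rewrite (h x y) ?ys // ?inE ?eqxx ?ys ?orbT.
Qed.

Lemma card_image_seq (T : eqType) U (s : seq T) (f : T -> U) :
  uniq s -> {in s &, injective f} -> (f @` [set` s] #= `I_(size s))%card.
Proof.
case: s => [|x0 s0] us fi.
  by rewrite (_ : [set` [::]] = set0) ?image_set0 ?II0 // -subset0.
set s := x0 :: s0 in us fi *.
have -> : f @` [set` s] = (fun i => f (nth x0 s i)) @` `I_(size s).
  apply/seteqP; split=> _ [x xs <-].
    by exists (index x s); [change (index x s < size s)%N; rewrite index_mem | rewrite nth_index].
  by exists (nth x0 s x) => //; apply: mem_nth.
apply: inj_card_eq => i j; rewrite !inE => /= li lj /fi E.
by apply/eqP; rewrite -(nth_uniq x0 (s := s) li lj us) E ?mem_nth.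
Qed.

(** * From a subdivision to the counting equations *)

Section Subdivisions.
Variables (R : realType) (n : nat) (C : set (set (plane R))).
Hypothesis subC : semiuniform_linear_subdivision n C.

Let a (L : label) : bool := `[< C (cell R L) >].

Lemma cell_sub_Delta L : a L -> cell R L `<=` Delta R n.
Proof. by case: subC => -[_ <-] _ /asboolP CL p Lp; exists (cell R L). Qed.

(** The centroid of the triangle lies in Delta_n, hence in some cell, which by [cell_centroid]
    covers the whole triangle. *)
Lemma covering_has (e : bool) (i j : nat) : (i + j + e < n)%N -> has a (covering e i j).
Proof.
move=> ijn; have : Delta R n (centroid R e i j).
  have ijR : ((i + j + e)%N%:R + 1 <= n%:R :> R) by rewrite natr1 ler_nat.
  rewrite !natrD in ijR; have := (ler0n R i, ler0n R j) => -[i0 j0].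
  by case: e ijR {ijn} => /= ijR; split; rewrite /= -?pmulrn; lra.
case: subC => -[_ <-] semi [P CP Pc].
have [L vL PL] := (semiuniform_cellP P).1 (semi _ CP); subst P.
apply/hasP; exists L; last exact/asboolP.
by rewrite mem_covering vL (cell_centroid Pc).
Qed.

(** Two cells that share a unit triangle meet in a common face containing it; by
    [unit_triangle_face] that face is each of the two cells. *)
Lemma covering_unique e i j :
  {in covering e i j &, forall L L', a L -> a L' -> L = L'}.
Proof.
move=> L L'; rewrite !mem_covering => /andP[vL cL] /andP[vL' cL'] aL aL'.
apply: (cell_inj (R := R)) => //; case: subC => -[[_ _ _ meet] _] _.
have [|fL fL'] := meet _ _ (asboolW aL) (asboolW aL').
  exists (pt (i + e)%:~R (j + e)%:~R).
  by split; apply: covers_cell; [exact: cL | left; left | exact: cL' | left; left].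
have VI : triangle_vertices e i j `<=` cell R L `&` cell R L'.
  by move=> p Vp; split; apply: covers_cell Vp.
by rewrite -(unit_triangle_face fL VI); exact: unit_triangle_face fL' VI.
Qed.

Lemma count_covering (e : bool) (i j : nat) : count a (covering e i j) = (i + j + e < n)%N.
Proof.
rewrite (count_unique (covering_uniq e i j) (@covering_unique e i j)).
have [ijn|nij] := ltnP (i + j + e) n; first by rewrite covering_has.
(* Outside Delta_n a vertex of the triangle violates x + y <= n: one with sum i + j + 1 for an
   upward triangle, the one with sum i + j + 2 for a downward triangle. *)
case: hasP => // -[L]; rewrite mem_covering => /andP[_ cL] /cell_sub_Delta LD.
have [] := LD _ (covers_cell cL (or_introl (or_intror erefl))).
rewrite /= -intrD => _ _; rewrite (_ : n%:R = n%:Z%:~R) // ler_int.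
have [] := LD _ (covers_cell cL (or_introl (or_introl erefl))).
rewrite /= -intrD => _ _; rewrite (_ : n%:R = n%:Z%:~R) // ler_int.
by case: e {LD cL} nij => /=; lia.
Qed.

Lemma cell_origin L : cell R L (pt (L.1.2)%:~R (L.2)%:~R).
Proof.
case: L => [[[[[c w1] w2] w3] k] l].
have := (ler0n R w1, ler0n R w2, ler0n R w3, ler0n R c) => -[[[? ?] ?] ?].
by split=> /=; lra.
Qed.

(** The translation vector of a cell belongs to the cell and so to Delta_n; hence sums over the grid
    miss no cell. *)
Lemma label_nat L : a L -> exists i j : nat, [/\ L.1.2 = i, L.2 = j & (i + j <= n)%N].
Proof.
move=> /cell_sub_Delta/(_ _ (cell_origin L))[/=].
rewrite -intrD (_ : n%:R = n%:Z%:~R) // ler_int !ler0z => k0 l0 kl.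
exists `|L.1.2|%N, `|L.2|%N; split; lia.
Qed.
Definition cells_of (f : int -> int -> label) : seq label :=
  [seq f x.1 x.2 | x : 'I_n.+1 * 'I_n.+1 in [pred x : 'I_n.+1 * 'I_n.+1 | a (f x.1 x.2)]].

Lemma size_cells_of f : size (cells_of f) = grid_sum n (fun i j => a (f i j)).
Proof.
rewrite size_map -cardE -sum1_card big_mkcond /grid_sum pair_big.
by apply: eq_bigr => x _ /=; rewrite inE; case: (a _).
Qed.

Lemma mem_cells_of f L : (forall i j, (f i j).1.2 = i /\ (f i j).2 = j) ->
  L \in cells_of f <-> a L /\ exists k l, L = f k l.
Proof.
move=> fE; split.
  by move=> /mapP[x]; rewrite mem_enum => ax ->; split; [exact: ax | exists x.1%:Z; exists x.2%:Z].
move=> [aL [k [l Lf]]]; have [i [j [ki lj ij]]] := label_nat aL.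
apply/mapP; have i_n : (i < n.+1)%N by lia.
have j_n : (j < n.+1)%N by lia.
move: (fE k l); rewrite -Lf ki lj => -[ik jl].
have LE : L = f i j by rewrite ik jl.
exists (Ordinal i_n, Ordinal j_n); last exact: LE.
by rewrite mem_enum; change (is_true (a (f i j))); rewrite -LE.
Qed.

Lemma cells_of_uniq f : (forall i j, (f i j).1.2 = i /\ (f i j).2 = j) ->
  uniq (cells_of f).
Proof.
move=> fE; rewrite map_inj_uniq ?enum_uniq // => x y E.
have [e1 e2] := fE x.1%:Z x.2%:Z; rewrite E in e1 e2.
have [e3 e4] := fE y.1%:Z y.2%:Z; rewrite e3 in e1; rewrite e4 in e2.
by case: x y {E e3 e4} e1 e2 => [x1 x2] [y1 y2] /= [/val_inj-> ] [/val_inj->].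
Qed.

(** Cells are counted through their labels, which [cell_inj] allows; the three kinds of
    parallelograms have disjoint sets of labels. *)
Lemma card_parallelograms : (parallelograms C #= `I_(
  grid_sum n (fun i j => a (par1 i j)) + grid_sum n (fun i j => a (par2 i j)) +
  grid_sum n (fun i j => a (par3 i j))))%card.
Proof.
rewrite -!size_cells_of -!size_cat.
set s := _ ++ _.
have memE L : L \in s <-> a L /\ exists k l, [\/ L = par1 k l, L = par2 k l | L = par3 k l].
  rewrite !mem_cat; split.
    by move=> /orP[/orP[]|] /mem_cells_of[] // aL [k [l E]];
      (split; [exact: aL | exists k; exists l]);
      [apply: Or31 | apply: Or32 | apply: Or33].
  move=> [aL [k [l E]]]; apply/orP; case: E => E.
  - left; apply/orP; left; apply/mem_cells_of => //.
    by split; [exact: aL | exists k; exists l].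
  - left; apply/orP; right; apply/mem_cells_of => //.
    by split; [exact: aL | exists k; exists l].
  - right; apply/mem_cells_of => //.
    by split; [exact: aL | exists k; exists l].
have -> : parallelograms C = cell R @` [set` s].
  apply/seteqP; split.
    move=> Q [CQ /parallelogramP[k [l E]]].
    have mem L : Q = cell R L ->
        (exists k l, [\/ L = par1 k l, L = par2 k l | L = par3 k l]) ->
        (cell R @` [set` s]) Q.
      move=> QL hL; exists L; last by rewrite QL.
      by apply/memE; split; [apply/asboolP; rewrite -QL | ].
    case: E => E; apply: (mem _ E); exists k; exists l;
      [exact: Or33 | exact: Or31 | exact: Or32].
  move=> _ [L /memE[/asboolP CL [k [l E]]] <-]; split=> //.
  apply/parallelogramP; exists k, l; case: E => ->; [exact: Or32 | exact: Or33 | exact: Or31].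
apply: card_image_seq.
  rewrite !cat_uniq !cells_of_uniq // andbT /= andbT.
  apply/andP; split; apply/hasPn => L /mem_cells_of[] // _ [k [l ->]].
    by apply/negP => /mem_cells_of[] // _ [k' [l' ]].
  rewrite mem_cat; apply/negP => /orP[] /mem_cells_of[] // _ [k' [l' ]] //.
move=> L L' /memE[_ [k [l E]]] /memE[_ [k' [l' E']]]; apply: cell_inj.
  by case: E => ->.
by case: E' => ->.
Qed.

Lemma not_cell L (x y : int) : (x < 0) || (y < 0) ->
  cell R L (pt x%:~R y%:~R) -> a L = false :> bool.
Proof.
move=> xy Lp; apply/negP => /cell_sub_Delta/(_ _ Lp)[/=].
by rewrite !ler0z; lia.
Qed.

Lemma parallelograms_ge : (0 < n)%N ->
  ((if 3 %| n then n - 3 else n - 1) <=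
  grid_sum n (fun i j => a (par1 i j)) + grid_sum n (fun i j => a (par2 i j)) +
  grid_sum n (fun i j => a (par3 i j)))%N.
Proof.
have S (m : nat) : m.+1%:Z = m%:Z + 1 by lia.
apply: (@parallelogram_bound n (fun i j => a (tri i j)) _ _ _
  (fun i j => a (hexa i j))).
- move=> i j; have := count_covering false i j; rewrite addn0 => <-.
  by rewrite /= !S !addnA addn0.
- move=> i j; rewrite (_ : i + j.+1 = i + j + true)%N -?(count_covering true) /=; last by lia.
  by rewrite !S !addnA addn0.
(* Each boundary condition is witnessed by a lattice point of the cell with a coordinate equal to
   -1. *)
- by move=> j; rewrite (@not_cell _ (-1) (j%:Z + 1)) //; split=> /=; lra.
- by move=> i; rewrite (@not_cell _ i%:Z (-1)) ?orbT //; split=> /=; lra.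
- by move=> j; rewrite (@not_cell _ (-1) j%:Z) //; split=> /=; lra.
- by move=> i; rewrite (@not_cell _ i%:Z (-1)) ?orbT //; split=> /=; lra.
- by move=> j; rewrite (@not_cell _ (-1) j%:Z) //; split=> /=; lra.
- by move=> i; rewrite (@not_cell _ i%:Z (-1)) ?orbT //; split=> /=; lra.
Qed.

End Subdivisions.

(** * The extremal subdivision *)

Section Construction.
Variable R : realType.

(** The branches are: interior center, left side, bottom side, hypotenuse. Each corner falls into a
    branch whose inner test fails there, which leaves the single triangle. *)
Definition tiles_at (n i j : nat) : seq label :=
  if [&& 0 < i, 0 < j & i + j < n]%N then [:: hexa i j]
  else if (i == 0%N) && (j < n)%N then
    tri 0 j :: (if (0 < j)%N then [:: par2 0 j] else [::])
  else if j == 0%N then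
    tri (i%:Z - 1) 0 :: (if (i < n)%N then [:: par1 i 0] else [::])
  else tri i (j%:Z - 1) :: (if (0 < i)%N then [:: par3 i j] else [::]).

Definition centers (n : nat) : seq (nat * nat) :=
  [seq v <- [seq (i, j) | i <- iota 0 n.+1, j <- iota 0 n.+1] |
    (v.1 + v.2 <= n) && (v.1 == v.2 %[mod 3])]%N.

Definition tiles (n : nat) : seq label :=
  flatten [seq tiles_at n v.1 v.2 | v <- centers n].

Lemma mem_centers n i j :
  ((i, j) \in centers n) = (i + j <= n)%N && (i == j %[mod 3])%N.
Proof.
have mem : (i + j <= n)%N -> (i, j) \in [seq (i, j) | i <- iota 0 n.+1, j <- iota 0 n.+1].
  by move=> ij; apply: allpairs_f; rewrite mem_iota; lia.
by rewrite mem_filter; case: leqP mem => [ij -> //|]; rewrite ?andbT.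
Qed.

Lemma mem_tiles n L : reflect (exists i j, [/\ (i + j <= n)%N, (i == j %[mod 3])%N &
  L \in tiles_at n i j]) (L \in tiles n).
Proof.
apply: (iffP flatten_mapP) => [[[i j]]|[i [j [ij m Lt]]]].
  by rewrite mem_centers => /andP[? ?] ?; exists i, j.
by exists (i, j); rewrite ?mem_centers ?ij.
Qed.

(** The cell lies in the hexagon formed by the six unit triangles at (i, j). *)
Definition in_star L (i j : int) : bool :=
  let: (c, w1, w2, w3, k, l) := L in
  [&& i - 1 <= k - w1%:Z, k + w3%:Z + c%:Z <= i + 1,
      j - 1 <= l - w2%:Z, l + w1%:Z + c%:Z <= j + 1,
      i + j - 1 <= k + l - w2%:Z & k + l + w3%:Z + c%:Z <= i + j + 1].

Lemma tiles_at_cases n i j L : (0 < n)%N -> (i + j <= n)%N -> L \in tiles_at n i j ->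
  [\/ L = hexa i j /\ [&& 0 < i, 0 < j & i + j < n]%N,
      [\/ L = tri 0 j /\ (i == 0%N) && (j < n)%N,
      L = tri (i%:Z - 1) 0 /\ (0 < i)%N && (j == 0%N) |
      L = tri i (j%:Z - 1) /\ (0 < j)%N && (i + j == n)%N] |
      [\/ L = par2 0 j /\ [&& i == 0, 0 < j & j < n]%N,
      L = par1 i 0 /\ [&& j == 0, 0 < i & i < n]%N |
      L = par3 i j /\ [&& 0 < i, 0 < j & i + j == n]%N]].
Proof.
move=> n0 ij; rewrite /tiles_at.
case: ifP => [hx|hx]; first by rewrite inE => /eqP ->; apply: Or31.
case: ifP => [lf|lf].
  rewrite inE => /orP[/eqP ->|]; first by apply/Or32/Or31.
  by case: ifP => // j0; rewrite inE => /eqP ->; apply/Or33/Or31; split=> //; lia.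
case: ifP => [bt|bt].
  rewrite inE => /orP[/eqP ->|]; first by apply/Or32/Or32; split=> //; lia.
  by case: ifP => // j0; rewrite inE => /eqP ->; apply/Or33/Or32; split=> //; lia.
rewrite inE => /orP[/eqP ->|]; first by apply/Or32/Or33; split=> //; lia.
by case: ifP => // j0; rewrite inE => /eqP ->; apply/Or33/Or33; split=> //; lia.
Qed.

Lemma tiles_at_valid n i j : all valid (tiles_at n i j).
Proof. by rewrite /tiles_at; do !case: ifP. Qed.

Lemma tiles_at_star n i j L : (0 < n)%N -> (i + j <= n)%N ->
  L \in tiles_at n i j -> in_star L i j.
Proof.
by move=> n0 ij /(tiles_at_cases n0 ij)[[-> ?]|[] [-> ?]|[] [-> ?]] /=; lia.
Qed.

Lemma tiles_at_below n i j L L' : (0 < n)%N -> (i + j <= n)%N ->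
  L \in tiles_at n i j -> L' \in tiles_at n i j ->
  [\/ L = L', below L L' | below L' L].
Proof.
move=> n0 ij.
move=> /(tiles_at_cases n0 ij)[[-> ?]|[] [-> ?]|[] [-> ?]];
move=> /(tiles_at_cases n0 ij)[[-> ?]|[] [-> ?]|[] [-> ?]].
all: try by exfalso; lia.
all: try by apply: Or31.
all: try by apply: Or32; rewrite /=; lia.
all: try by apply: Or33; rewrite /=; lia.
Qed.

(** The difference (d, d') of two centers satisfies d = d' mod 3. If both entries have absolute
    value at most 1 they are equal, so d + d' is 2 or -2; thus some coordinate x, y or x + y
    separates the two hexagons. *)
Lemma star_below L L' (i j i' j' : nat) : (i == j %[mod 3])%N -> (i' == j' %[mod 3])%N ->
  (i, j) != (i', j') -> in_star L i j -> in_star L' i' j' -> below L L' || below L' L.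
Proof.
case: L => [[[[[c w1] w2] w3] k] l]; case: L' => [[[[[c' w1'] w2'] w3'] k'] l'].
move=> m m' ne s s'.
have : [|| i'%:Z + 1 <= i%:Z - 1, i%:Z + 1 <= i'%:Z - 1, j'%:Z + 1 <= j%:Z - 1,
  j%:Z + 1 <= j'%:Z - 1, i'%:Z + j'%:Z + 1 <= i%:Z + j%:Z - 1 |
  i%:Z + j%:Z + 1 <= i'%:Z + j'%:Z - 1].
  clear s s'; rewrite xpair_eqE in ne; lia.
clear m m' ne; move: s s' => /= s s' h; lia.
Qed.

Lemma tiles_below n L L' : (0 < n)%N -> L \in tiles n -> L' \in tiles n ->
  [\/ L = L', below L L' | below L' L].
Proof.
move=> n0 /mem_tiles[i [j [ij m Lt]]] /mem_tiles[i' [j' [ij' m' Lt']]].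
have [E|ne] := eqVneq (i, j) (i', j').
  by case: E Lt' => <- <- Lt'; exact: tiles_at_below Lt Lt'.
have := star_below m m' ne (tiles_at_star n0 ij Lt) (tiles_at_star n0 ij' Lt').
by case/orP; [apply: Or32 | apply: Or33].
Qed.

Lemma Delta_triangle n (x y : R) : (0 < n)%N -> 0 <= x -> 0 <= y -> x + y <= n%:R ->
  exists (a b : nat) (e : bool), [/\ (a + b + e < n)%N, a%:R <= x <= a%:R + 1,
    b%:R <= y <= b%:R + 1 & a%:R + b%:R + e%:R <= x + y <= a%:R + b%:R + e%:R + 1].
Proof.
move=> n0 x0 y0 xyn; pose a := Num.truncn x; pose b := Num.truncn y.
have /andP[ax xa] : a%:R <= x < a%:R + 1 by rewrite natr1 truncn_itv.
have /andP[by_ yb] : b%:R <= y < b%:R + 1 by rewrite natr1 truncn_itv.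
have le (m : nat) : m%:R <= x + y -> (m <= n)%N.
  by move=> mxy; rewrite -(ler_nat R); exact: le_trans xyn.
have [xy|xy] := leP (x + y) (a%:R + b%:R + 1); last first.
  exists a, b, true; split; rewrite /=; try lra.
  rewrite -(ltr_nat R) !natrD; lra.
have [abn|abn] := ltnP (a + b) n.
  by exists a, b, false; split; rewrite /= ?addn0 //; lra.
(* The point is then the lattice point (a, b) on the hypotenuse; it is a vertex of the upward
   triangle one step to the left, or one step down if a = 0. *)
have abE : (a + b = n)%N.
  by apply/eqP; rewrite eqn_leq abn andbT; apply: le; rewrite natrD; lra.
have abR : a%:R + b%:R = n%:R :> R by rewrite -abE natrD.
have [a0|a0] := posnP a.
  have b0 : (0 < b)%N by rewrite -abE a0 in n0.
  have bE : b%:R = b.-1%:R + 1 :> R by rewrite natr1 prednK.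
  by exists a, b.-1, false; split; rewrite /= ?addn0 //; [lia | lra..].
have aE : a%:R = a.-1%:R + 1 :> R by rewrite natr1 prednK.
by exists a.-1, b, false; split; rewrite /= ?addn0 //; [lia | lra..].
Qed.

(* Every unit lattice triangle has one vertex in each class of i - j mod 3. *)
Lemma Delta_center n (x y : R) : (0 < n)%N -> 0 <= x -> 0 <= y -> x + y <= n%:R ->
  exists i j : nat, [/\ (i + j <= n)%N, (i == j %[mod 3])%N &
    [/\ i%:R - 1 <= x <= i%:R + 1, j%:R - 1 <= y <= j%:R + 1 &
        i%:R + j%:R - 1 <= x + y <= i%:R + j%:R + 1]].
Proof.
move=> n0 x0 y0 /(Delta_triangle n0 x0 y0)[a [b [e [abn ax by_ abz]]]].
have : (a == b %[mod 3])%N || (a.+1 == b %[mod 3])%N || (a == b.+1 %[mod 3])%N by lia.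
case: e abn abz => /=; rewrite ?addn0 ?addr0 => abn abz /orP[/orP[]|] m.
- exists a.+1, b.+1; rewrite -!natr1; split; [lia | lia | split; lra].
- exists a.+1, b; rewrite -!natr1; split; [lia | lia | split; lra].
- exists a, b.+1; rewrite -!natr1; split; [lia | lia | split; lra].
- exists a, b; split; [lia | lia | split; lra].
- exists a.+1, b; rewrite -!natr1; split; [lia | lia | split; lra].
- exists a, b.+1; rewrite -!natr1; split; [lia | lia | split; lra].
Qed.

(** At a boundary center the trapezoid is cut along a lattice line through the center: y = j on the
    left side, x + y = i on the bottom, x = i on the hypotenuse. *)
Lemma star_covered n (i j : nat) (x y : R) : (0 < n)%N -> (i + j <= n)%N ->
  0 <= x -> 0 <= y -> x + y <= n%:R ->
  i%:R - 1 <= x <= i%:R + 1 -> j%:R - 1 <= y <= j%:R + 1 ->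
  i%:R + j%:R - 1 <= x + y <= i%:R + j%:R + 1 ->
  exists2 L, L \in tiles_at n i j & cell R L (pt x y).
Proof.
move=> n0 ijn x0 y0 xyn xi yj zij; rewrite /tiles_at.
case: ifP => [hx|hx].
  by exists (hexa i j); [rewrite inE | split=> /=; lra].
case: ifP => [/andP[/eqP i0 jn]|lf].
  subst i; have [jy|yj'] := leP j%:R y.
    by exists (tri 0 j); [rewrite inE eqxx | split=> /=; lra].
  have [j0|j0] := posnP j; first by subst j; exfalso; lra.
  by exists (par2 0 j); [rewrite !inE eqxx orbT | split=> /=; lra].
case: ifP => [/eqP j0|bt].
  subst j; have [zi|iz] := leP (x + y) i%:R.
    by exists (tri (i%:Z - 1) 0); [rewrite inE eqxx | split=> /=; lra].
  have [i_n|ni] := ltnP i n.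
    by exists (par1 i 0); [rewrite !inE eqxx orbT | split=> /=; lra].
  by move: ni; rewrite -(ler_nat R) => ni; exfalso; lra.
have ijR : i%:R + j%:R = n%:R :> R by rewrite -natrD; congr _%:R; lia.
have [ix|xi'] := leP i%:R x.
  by exists (tri i (j%:Z - 1)); [rewrite inE eqxx | split=> /=; lra].
have [i0|i0] := posnP i; first by subst i; exfalso; lra.
by exists (par3 i j); [rewrite !inE eqxx orbT | split=> /=; lra].
Qed.

Definition in_Delta (n : nat) L : bool :=
  let: (c, w1, w2, w3, k, l) := L in
  [&& 0 <= k - w1%:Z, 0 <= l - w2%:Z & k + l + w3%:Z + c%:Z <= n%:Z].

Lemma tiles_at_Delta n i j L : (0 < n)%N -> (i + j <= n)%N -> L \in tiles_at n i j ->
  cell R L `<=` Delta R n.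
Proof.
move=> n0 ij /(tiles_at_cases n0 ij) Lc; have : in_Delta n L.
  by case: Lc => [[-> ?]|[] [-> ?]|[] [-> ?]] /=; lia.
case: L {Lc} => [[[[[c w1] w2] w3] k] l] /=; rewrite -!(ler_int R) => /and3P[h1 h2 h3].
by elim/pt_ind=> x y [/= ? ? ?]; split=> /=; lra.
Qed.

Lemma tiles_subdivision n : (0 < n)%N ->
  semiuniform_linear_subdivision n (@complex_of R (tiles n)).
Proof.
move=> n0; have vt : all valid (tiles n).
  by apply/allP => L /mem_tiles[i [j [_ _ Lt]]]; exact: (allP (tiles_at_valid n i j)).
split; last first.
  move=> F [L Lt /face_cellP[L' L'L ->]]; apply/semiuniform_cellP; exists L' => //.
  exact: valid_faces (allP vt _ Lt) L'L.
split; first by apply: polyhedral_complex_of => // L L'; exact: tiles_below.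
apply/seteqP; split=> [p [F [L /mem_tiles[i [j [ij m Lt]]] fL] Fp]|].
  by apply: (tiles_at_Delta n0 ij Lt); exact: (face_sub fL).
elim/pt_ind=> x y [/= x0 y0 xyn].
have [i [j [ij m [hx hy hz]]]] := Delta_center n0 x0 y0 xyn.
have [L Lt Lp] := star_covered n0 ij x0 y0 xyn hx hy hz.
exists (cell R L) => //; exists L; last exact: face_refl.
by apply/mem_tiles; exists i, j.
Qed.

(** A cell of the complex is a face of some tile; if it covers a unit triangle it is the tile
    itself. *)
Lemma cell_tiles n L e i j : valid L -> covers e L i j ->
  @complex_of R (tiles n) (cell R L) -> L \in tiles n.
Proof.
move=> vL cL [L' L't fL]; have := unit_triangle_face fL (covers_cell cL).
move=> /cell_inj ->//.
by move/mem_tiles: L't => [a [b [_ _ Lt]]]; exact: (allP (tiles_at_valid n a b)).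
Qed.

Lemma tiles_cell n L : L \in tiles n -> @complex_of R (tiles n) (cell R L).
Proof. by exists L => //; exact: face_refl. Qed.

End Construction.

(** * The number of parallelograms in the extremal subdivision *)

Lemma grid_sum_graph n (P : nat -> bool) (f : nat -> nat) :
  (forall i, (i <= n)%N -> P i -> (f i <= n)%N) ->
  grid_sum n (fun i j => P i && (j == f i)) = (\sum_(i < n.+1) P i)%N.
Proof.
move=> fn; apply: eq_bigr => i _; have := fn i (leq_ord i).
case: (P i) => /= [/(_ isT) fi|_]; last by rewrite big1.
rewrite (bigD1 (Ordinal (fi : f i < n.+1)%N)) //= eqxx big1 // => j.
by rewrite -val_eqE /= => /negbTE ->.
Qed.

(** The quotient counts all i < N with residue r; the subtracted term removes i = 0. *)
Lemma sum_mod3 N r : (r < 3)%N ->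
  (\sum_(i < N) ((0 < i) && (i %% 3 == r)) = (N + 2 - r) %/ 3 - ((r == 0) && (0 < N)))%N.
Proof.
move=> r3; elim: N => [|N IH]; first by rewrite big_ord0; lia.
by rewrite big_ord_recr /= IH; lia.
Qed.

Lemma par1_tiles n i j : (0 < n)%N -> (par1 i%:Z j%:Z \in tiles n) =
  [&& 0 < i, i < n & i %% 3 == 0]%N && (j == 0)%N.
Proof.
move=> n0; apply/mem_tiles/idP => [[a [b [ab m]]]|/andP[/and3P[i0 i_n i3] /eqP ->]].
  move=> /(tiles_at_cases n0 ab)[[E ?]|[] [E ?]|[] [E ?]] //.
  by case: E => [-> ->]; lia.
exists i, 0%N; split; [lia | by rewrite (eqP i3) | ].
by rewrite /tiles_at i_n andbF /= gtn_eqF // !inE eqxx orbT.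
Qed.

Lemma par2_tiles n i j : (0 < n)%N -> (par2 i%:Z j%:Z \in tiles n) =
  [&& 0 < j, j < n & j %% 3 == 0]%N && (i == 0)%N.
Proof.
move=> n0; apply/mem_tiles/idP => [[a [b [ab m]]]|/andP[/and3P[j0 j_n j3] /eqP ->]].
  move=> /(tiles_at_cases n0 ab)[[E ?]|[] [E ?]|[] [E ?]] //.
  by case: E => [-> ->]; lia.
exists 0%N, j; split; [lia | by rewrite (eqP j3) | ].
by rewrite /tiles_at j_n /= j0 !inE eqxx orbT.
Qed.

(** On the hypotenuse j = n - i, so i = j mod 3 means 2i = n, that is i = 2n mod 3. *)
Lemma par3_tiles n i j : (0 < n)%N -> (par3 i%:Z j%:Z \in tiles n) =
  [&& 0 < i, i < n & i %% 3 == (2 * n) %% 3]%N && (j == n - i)%N.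
Proof.
move=> n0; apply/mem_tiles/idP => [[a [b [ab m]]]|/andP[/and3P[i0 i_n i3] /eqP ->]].
  move=> /(tiles_at_cases n0 ab)[[E ?]|[] [E ?]|[] [E ?]] //.
  by case: E => [-> ->]; lia.
exists i, (n - i)%N; split; [lia | lia | ].
have [e1 e2 e3] : [/\ (i + (n - i) < n) = false, (i == 0) = false &
    (n - i == 0) = false]%N by split; lia.
by rewrite /tiles_at e1 e2 e3 i0 !andbF !inE eqxx orbT.
Qed.

Lemma tiles_par_count n : (0 < n)%N ->
  (grid_sum n (fun i j => par1 i j \in tiles n) +
   grid_sum n (fun i j => par2 i j \in tiles n) +
   grid_sum n (fun i j => par3 i j \in tiles n))%N =
  (if 3 %| n then n - 3 else n - 1)%N.
Proof.
move=> n0.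
have sumE r : (r < 3)%N -> (\sum_(i < n.+1) [&& 0 < i, i < n & i %% 3 == r] =
    (n + 2 - r) %/ 3 - (r == 0))%N.
  move=> r3; rewrite big_ord_recr /= ltnn andbF addn0.
  have -> : (r == 0)%N = (r == 0)%N && (0 < n)%N by rewrite n0 andbT.
  by rewrite -sum_mod3 //; apply: eq_bigr => i _; rewrite ltn_ord.
have -> : grid_sum n (fun i j => par1 i j \in tiles n) = ((n + 2) %/ 3 - 1)%N.
  have /= := sumE 0%N isT; rewrite subn0 => <-.
  rewrite (@eq_grid_sum n _ (fun i j => [&& 0 < i, i < n & i %% 3 == 0] && (j == 0))%N).
    exact: (grid_sum_graph (f := fun=> 0%N)).
  by move=> i j; rewrite par1_tiles.
have -> : grid_sum n (fun i j => par2 i j \in tiles n) = ((n + 2) %/ 3 - 1)%N.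
  have /= := sumE 0%N isT; rewrite subn0 => <-.
  rewrite /grid_sum exchange_big.
  rewrite -[LHS]/(grid_sum n (fun j i => par2 i j \in tiles n)).
  rewrite (@eq_grid_sum n _ (fun j i => [&& 0 < j, j < n & j %% 3 == 0] && (i == 0))%N).
    exact: (grid_sum_graph (f := fun=> 0%N)).
  by move=> i j; rewrite par2_tiles.
have -> : grid_sum n (fun i j => par3 i j \in tiles n) =
    ((n + 2 - (2 * n) %% 3) %/ 3 - ((2 * n) %% 3 == 0))%N.
  rewrite -sumE; last by rewrite ltn_mod.
  rewrite (@eq_grid_sum n _ (fun i j =>
    [&& 0 < i, i < n & i %% 3 == (2 * n) %% 3] && (j == n - i))%N).
    by apply: grid_sum_graph => i _ _; exact: leq_subr.
  by move=> i j; rewrite par3_tiles.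
(* The three sides carry q - 1 parallelograms each if n = 3q, q each if n = 3q + 1, and q, q, q + 1
   if n = 3q + 2. *)
case: ifP => n3; lia.
Qed.

Local Open Scope card_scope.

(* `I_k is the initial segment {0, ..., k - 1}, so that `I_k #<= A and
   A #= `I_k say that A has at least, resp. exactly, k elements. *)
Theorem theorem3p3p1 (R : realType) (n : nat) (n_gt0 : (0 < n)%N) :
  (forall C : set (set (plane R)), semiuniform_linear_subdivision n C ->
     `I_(if (3 %| n)%N then (n - 3)%N else (n - 1)%N) #<= parallelograms C) /\
  (exists C : set (set (plane R)), semiuniform_linear_subdivision n C /\
     parallelograms C #= `I_(if (3 %| n)%N then (n - 3)%N else (n - 1)%N)).
Proof.
split=> [C subC|].
  rewrite (card_le_eqr (card_parallelograms subC)) card_le_II.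
  exact: parallelograms_ge.
have subT := tiles_subdivision R n_gt0.
exists (complex_of (tiles n)); split=> //.
rewrite -tiles_par_count //.
(* The three listed triangles are the downward triangles of [par1], [par2] and [par3] at (i, j);
   covering one of them lets [cell_tiles] identify the cell with a tile. *)
have E f : (forall i j : int, valid (f i j) &&
      has (fun v => covers v.1.1 (f i j) v.1.2 v.2)
        [:: (true, i - 1, j); (true, i, j - 1); (true, i - 1, j - 1)]) ->
    grid_sum n (fun i j => f i j \in tiles n) =
    grid_sum n (fun i j => `[< complex_of (tiles n) (cell R (f i j)) >]).
  move=> fE; apply: eq_grid_sum => i j; congr nat_of_bool.
  apply/idP/asboolP; first exact: tiles_cell.
  have /andP[vf /hasP[[[e k] l] _ cv]] := fE i j; exact: cell_tiles vf cv.
rewrite !E; first exact: card_parallelograms.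
all: by move=> i j /=; lia.
Qed.
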